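(* The KickNext algorithm with parameter $p=0.08$ is $0.053$-competitive for the laminar matroid secretary problem: for every laminar matroid and every (nonnegative, distinct) weight assignment, its output $SOL$ satisfies $\mathbb E[w(SOL)]\ge 0.053\,w(\mathrm{OPT})$.
   Context: Let $U$ be a finite ground set, $n=|U|$, with weight function $w:U\to\mathbb{R}_{\ge0}$ taking pairwise distinct values; for $X\subseteq U$, $w(X)=\sum_{x\in X}w(x)$. Let $\mathcal F$ be a laminar family of subsets of $U$ (for any $A,B\in\mathcal F$: $A\subseteq B$, $B\subseteq A$, or $A\cap B=\emptyset$) with $U\in\mathcal F$; each $A\in\mathcal F$ has a positive integer capacity $\mu(A)$, with $\mu(A)<\mu(B)$ whenever $A\subsetneq B$. A set $X\subseteq U$ is independent iff $|X\cap A|\le\mu(A)$ for all $A\in\mathcal F$. For $i\in U$, $M(i)$ denotes the minimal member of $\mathcal F$ containing $i$. For $A\subseteq B$ in $\mathcal F$, $\mathrm{Chain}[A,B]$ is the sequence of all $B'\in\mathcal F$ with $A\subseteq B'\subseteq B$, ordered by inclusion from $A$ up to $B$. For $V\subseteq U$ and $B\in\mathcal F$, $\mathrm{OPT}_V(B)$ is the maximum-weight independent subset of $V\cap B$; $\mathrm{OPT}=\mathrm{OPT}_U(U)$. Random model (with parameter $p\in(0,1)$): a uniformly random ordering $\pi$ of $U$ is drawn and, independently, $t\sim\mathrm{Binom}(n,1-p)$; $S=\{\pi(1),\dots,\pi(t)\}$ and $T=U\setminus S$. KickNext algorithm: for each $B\in\mathcal F$ initialize $R(B)=\mathrm{OPT}_S(B)$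 and $SOL(B)=\emptyset$. Process the elements $i\in T$ in the order $\pi$; for each such $i$, visit the sets $B\in\mathrm{Chain}[M(i),U]$ in order from $M(i)$ upward; at each visited $B$: if $R(B)$ contains an element of weight less than $w(i)$, add $i$ to $SOL(B)$, remove from $R(B)$ the element of largest weight among those of weight less than $w(i)$, and continue to the next set in the chain; otherwise stop processing $i$. The output is $SOL=SOL(U)$. Standing convention of the paper: by padding $U$ with dummy elements of infinitesimal weight, one assumes $|\mathrm{OPT}_S(B)|=\mu(B)$ for every $B\in\mathcal F$. *)

(* Defs.v *)
From HB Require Import structures.
From mathcomp Require Import all_boot all_order all_algebra.
From mathcomp Require Import fingroup perm.
Set Implicit Arguments. Unset Strict Implicit. Unset Printing Implicit Defensive.
Import Order.TTheory GRing.Theory Num.Theory.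
Local Open Scope ring_scope.

Section Laminar.
Variables (R : realFieldType) (T : finType).

Definition laminar (F : {set {set T}}) : bool :=
  [forall A in F, forall B in F,
     [|| A \subset B, B \subset A | [disjoint A & B]]].

Definition indep (F : {set {set T}}) (mu : {set T} -> nat) (X : {set T}) : bool :=
  [forall A in F, #|X :&: A| <= mu A]%N.

Definition wsum (w : T -> R) (X : {set T}) : R := \sum_(x in X) w x.

(** X is a maximum-weight independent subset of V :&: B (ties, which can only
    arise through a weight-0 element, broken in favour of larger cardinality) *)
Definition isOPT (F : {set {set T}}) (mu : {set T} -> nat) (w : T -> R)
    (V B X : {set T}) : bool :=
  [&& X \subset V :&: B, indep F mu X &
      [forall Y : {set T}, ((Y \subset V :&: B) && indep F mu Y) ==>
          ((wsum w Y < wsum w X) || ((wsum w Y == wsum w X) && (#|Y| <= #|X|)%N))]].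

Definition OPT F mu w (V B : {set T}) : {set T} :=
  odflt set0 [pick X : {set T} | isOPT F mu w V B X].

(** state of KickNext: for each set B, the real elements of R(B), the number
    of dummy (padding) elements still in R(B), and SOL(B). *)
Record state := State {
  Rreal : {set T} -> {set T};
  Rdummy : {set T} -> nat;
  Sol : {set T} -> {set T} }.

Definition init_state F mu w (S : {set T}) : state :=
  State (fun B => OPT F mu w S B)
        (fun B => (mu B - #|OPT F mu w S B|)%N)
        (fun _ => set0).

(** one kick at a set with real part Rr and d dummies by element i:
    remove the heaviest element lighter than i (dummies are lighter than
    every real element); None if nothing is lighter. *)
Definition kick (w : T -> R) (i : T) (Rr : {set T}) (d : nat)
    : option ({set T} * nat) :=
  let L := [set x in Rr | w x < w i] in
  if [pick x in L | [forall y in L, w y <= w x]] is Some x then Some (Rr :\ x, d)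
  else if (0 < d)%N then Some (Rr, d.-1) else None.

Definition upd (st : state) (B : {set T}) (Rr : {set T}) (d : nat) (i : T) :=
  State (fun B' => if B' == B then Rr else Rreal st B')
        (fun B' => if B' == B then d else Rdummy st B')
        (fun B' => if B' == B then i |: Sol st B else Sol st B').

Fixpoint visit (w : T -> R) (i : T) (ch : seq {set T}) (st : state) : state :=
  match ch with
  | [::] => st
  | B :: rest =>
      match kick w i (Rreal st B) (Rdummy st B) with
      | Some (Rr, d) => visit w i rest (upd st B Rr d i)
      | None => st
      end
  end.

Definition chain (F : {set {set T}}) (i : T) : seq {set T} :=
  sort (fun A B : {set T} => A \subset B) [seq B <- enum F | i \in (B : {set T})].

Definition process F w (order : seq T) (st : state) : state :=
  foldl (fun st i => visit w i (chain F i) st) st order.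

End Laminar.

Definition sampleS n (pi : {perm 'I_n}) (t : nat) : {set 'I_n} :=
  [set pi k | k : 'I_n & (k < t)%N].

Definition arrivals n (pi : {perm 'I_n}) (t : nat) : seq 'I_n :=
  [seq pi k | k <- filter (fun k : 'I_n => (t <= k)%N) (enum 'I_n)].

Definition KickNext {R : realFieldType} n (F : {set {set 'I_n}})
    (mu : {set 'I_n} -> nat) (w : 'I_n -> R) (pi : {perm 'I_n}) (t : nat)
    : {set 'I_n} :=
  Sol (process F w (arrivals pi t) (init_state F mu w (sampleS pi t))) setT.

Definition expected_KickNext {R : realFieldType} n (F : {set {set 'I_n}})
    (mu : {set 'I_n} -> nat) (w : 'I_n -> R) (p : R) : R :=
  (n`!%:R)^-1 * \sum_(pi : {perm 'I_n}) \sum_(t < n.+1)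
     ('C(n, t)%:R * (1 - p) ^+ t * p ^+ (n - t) * wsum w (KickNext F mu w pi t)).

(* Main.v *)
(** Only the independence of the sample matters, not the arrival order.  Let O
    be the optimum.  If i in O arrives and is rejected at a set B, then, as for
    parking cars, the slots of OPT_S(B) below some threshold (dummies included)
    have all been kicked by elements of T below the same threshold.  If u is the
    number of these slots, then u is at least s = mu(B) - |{x in O, B : x > i}|,
    because i in O prevents every superset of B from being tight above i.  An
    element that reaches B is not spanned by the heavier part of S in B, and
    scanning B by decreasing weight, the unspanned elements are independent
    coins: either a new slot (probability q = 1 - p) or a car (probability p).
    Hence u cars fit below the threshold with probability at most W(u), the
    probability that u failures precede u successes.

    For a fixed s, every upper set Q of O contains the second component of at
    most (s + 1) |Q| pairs (B, i) with slack s, and Abel summation turns this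
    into a bound by (s + 1) w(O) on their total weight.  Indeed a laminar family
    has at most |Q| traces of size at least two on Q, a trace is repeated at
    most s times since mu is strictly increasing, and only once when it is a
    singleton.  The expected loss is therefore at most p w(O) times the sum over
    u of W(u) (2 + 3 + ... + (u + 1)), and for p = 0.08 this sum is less than
    0.3375 = 1 - 0.053 / 0.08. *)

Require Import Defs.
From HB Require Import structures.
From mathcomp Require Import all_boot all_order all_algebra.
From mathcomp Require Import fingroup perm.
From mathcomp Require Import zify ring lra.
Import Order.TTheory GRing.Theory Num.Theory.
Local Open Scope ring_scope.
Set Implicit Arguments. Unset Strict Implicit. Unset Printing Implicit Defensive.

(** * Optimal sets of a laminar matroid and their comparison between members *)

Section LaminarOptimum.
Variables (R : realFieldType) (T : finType) (F : {set {set T}}).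
Variables (mu : {set T} -> nat) (w : T -> R).
Hypothesis lamF : laminar F.
Hypothesis mu_mono :
  forall A B, A \in F -> B \in F -> A \proper B -> (mu A < mu B)%N.
Hypothesis w_ge0 : forall x, 0 <= w x.
Hypothesis w_inj : injective w.

Definition above (X : {set T}) (j : T) : {set T} := [set x in X | w j < w x].

Lemma aboveS (X : {set T}) j : above X j \subset X.
Proof. by apply/subsetP => x; rewrite inE => /andP[]. Qed.

Lemma above_mono (X : {set T}) i j : w j <= w i -> above X i \subset above X j.
Proof.
by move=> ji; apply/subsetP => x; rewrite !inE => /andP[-> /(le_lt_trans ji)].
Qed.

Lemma indepP (X C : {set T}) : indep F mu X -> C \in F -> (#|X :&: C| <= mu C)%N.
Proof. by move=> /forall_inP H /H. Qed.

Lemma indepS (X Y : {set T}) : X \subset Y -> indep F mu Y -> indep F mu X.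
Proof.
move=> XY iY; apply/forall_inP => C CF.
by apply: leq_trans (indepP iY CF); apply/subset_leq_card/setSI.
Qed.

Lemma laminarW A B x :
  A \in F -> B \in F -> x \in A -> x \in B -> A \subset B \/ B \subset A.
Proof.
move=> AF BF xA xB; move/forall_inP: lamF => /(_ _ AF)/forall_inP/(_ _ BF).
case/or3P => [||dis]; [by left|by right|].
by rewrite (disjointFr dis xA) in xB.
Qed.

(** The default [set0] in [OPT] is never reached: maximize the weight first, then the cardinality
    among the maximizers. *)
Lemma isOPT_OPT V B : isOPT F mu w V B (OPT F mu w V B).
Proof.
rewrite /OPT; case: pickP => //= none; exfalso.
pose P (X : {set T}) := (X \subset V :&: B) && indep F mu X.
have P0 : P set0.
  rewrite /P sub0set; apply/forall_inP => C _.
  by rewrite set0I cards0.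
have [X0 PX0 maxw] := arg_maxP (wsum w) P0.
pose P' X := P X && (wsum w X == wsum w X0).
have PX0' : P' X0 by rewrite /P' PX0 eqxx.
have [X /andP[/andP[PX1 PX2] /eqP PX3] maxc] := arg_maxnP (fun X : {set T} => #|X|) PX0'.
move: (none X); rewrite /isOPT PX1 PX2 /= => /negbT/negP; apply; apply/forallP => Y.
apply/implyP => PY; have : wsum w Y <= wsum w X0 by exact: maxw.
rewrite -PX3 le_eqVlt.
case/orP => [/eqP e|->//].
apply/orP; right; rewrite e eqxx /=; apply: maxc.
by rewrite /P' /P PY /= e PX3.
Qed.

Lemma OPT_sub V B : OPT F mu w V B \subset V :&: B.
Proof. by case/and3P: (isOPT_OPT V B). Qed.

Lemma OPT_indep V B : indep F mu (OPT F mu w V B).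
Proof. by case/and3P: (isOPT_OPT V B). Qed.

Lemma wsumD1 (X : {set T}) x : x \in X -> wsum w X = w x + wsum w (X :\ x).
Proof. by move=> xX; rewrite /wsum (big_setD1 x). Qed.

Lemma wsumU1 (X : {set T}) x : x \notin X -> wsum w (x |: X) = w x + wsum w X.
Proof. by move=> xX; rewrite /wsum big_setU1. Qed.

(* Exchange at a minimal tight set containing [e]: such a set cannot contain a
   chosen element lighter than [e]. *)
Lemma OPT_blocked (V B : {set T}) e : B \in F -> e \in V -> e \in B ->
  e \notin OPT F mu w V B ->
  exists C, [/\ C \in F, e \in C, C \subset B &
    (mu C <= #|above (OPT F mu w V B) e :&: C|)%N].
Proof.
set X := OPT F mu w V B => BF eV eB eX.
have XVB : X \subset V :&: B := OPT_sub V B.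
have iX : indep F mu X := OPT_indep V B.
have maxX (Y : {set T}) : Y \subset V :&: B -> indep F mu Y ->
    (wsum w Y < wsum w X) || ((wsum w Y == wsum w X) && (#|Y| <= #|X|)%N).
  move=> YVB iY; have /and3P[_ _ /forallP/(_ Y)] := isOPT_OPT V B.
  by rewrite YVB iY.
have eVB : e \in V :&: B by rewrite inE eV.
have eXVB : e |: X \subset V :&: B by rewrite subUset sub1set eVB.
pose tight (C : {set T}) := [&& C \in F, e \in C & (mu C <= #|X :&: C|)%N].
have [C0 tC0] : exists C, tight C.
  apply/existsP/contraT => /existsPn none.
  have iY : indep F mu (e |: X).
    apply/forall_inP => C CF; move: (none C); rewrite /tight CF /=.
    have [eC|eC] := boolP (e \in C) => /=; last first.
      move=> _; rewrite setIUl (_ : [set e] :&: C = set0) ?set0U ?indepP //.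
      by apply/setP => x; rewrite !inE; apply/negP => /andP[/eqP->]; apply/negP.
    rewrite -ltnNge; apply: leq_trans.
    by rewrite setIUl (leq_trans (leq_card_setU _ _).1) // -add1n leq_add2r
      -(cards1 e) subset_leq_card // subsetIl.
  (* Without a tight set [e] could be added. If [w e = 0] the weight does not grow, and the
     tie-break by cardinality gives the contradiction. *)
  have := maxX _ eXVB iY; rewrite wsumU1 // ltNge lerDr w_ge0 /=.
  by rewrite cardsU1 eX add1n ltnn andbF.
have [C /and3P[CF eC tC] minC] := arg_minnP (fun C : {set T} => #|C|) tC0.
have CB : C \subset B.
  case: (laminarW CF BF eC eB) => // BC.
  have [->//|nBC] := eqVneq B C.
  have := mu_mono BF CF; rewrite properEneq nBC BC => /(_ isT) mBC.
  have : (#|X :&: C| <= #|X :&: B|)%N.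
    apply/subset_leq_card/subsetP => x /setIP[xX xC].
    by rewrite inE xX; have /subsetP/(_ x xX) := XVB; rewrite inE => /andP[].
  by move=> /(leq_trans tC)/leq_trans/(_ (indepP iX BF)); rewrite leqNgt mBC.
exists C; split=> //; apply: (leq_trans tC); apply/subset_leq_card/subsetP => f.
move=> /setIP[fX fC]; rewrite !inE fX fC /= andbT.
rewrite ltNge; apply/negP => fe.
have {}fe : w f < w e.
  rewrite lt_neqAle fe andbT; apply/eqP => /w_inj fee.
  by rewrite fee in fX; rewrite fX in eX.
pose Y := e |: (X :\ f).
have eXf : e \notin X :\ f by rewrite !inE (negPf eX) andbF.
have YVB : Y \subset V :&: B.
  by apply: subset_trans eXVB; apply: setUS; apply: subsetDl.
have iY : indep F mu Y.
  apply/forall_inP => D DF.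
  have [eD|eD] := boolP (e \in D); last first.
    apply: leq_trans (indepP iX DF); apply/subset_leq_card/subsetP => x.
    rewrite !inE => /andP[/orP[/eqP->|/andP[_ ->//]]].
    by rewrite (negPf eD).
  have cY : (#|Y :&: D| <= (#|(X :\ f) :&: D|).+1)%N.
    rewrite setIUl (leq_trans (leq_card_setU _ _).1) // -add1n leq_add2r.
    by rewrite -(cards1 e) subset_leq_card // subsetIl.
  apply: (leq_trans cY).
  have [fD|fD] := boolP (f \in D).
    have := cardsD1 f (X :&: D); rewrite inE fX fD setIDAC add1n => <-.
    exact: indepP.
  (* The exchange can overfill only a set with [e] but without [f]. Such a set lies properly inside
     [C], so it is not tight by minimality. *)
  have DC : D \proper C.
    case: (laminarW DF CF eD eC) => [DC|/subsetP/(_ _ fC)]; last first.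
      by rewrite (negPf fD).
    by rewrite properE DC; apply/negP => /subsetP/(_ _ fC); apply/negP.
  have : ~~ tight D.
    by apply/negP => /minC; rewrite leqNgt proper_card.
  rewrite /tight DF eD /= -ltnNge; apply: leq_trans; rewrite ltnS.
  by apply/subset_leq_card/setSI/subsetDl.
have := maxX _ YVB iY; rewrite (wsumD1 fX) wsumU1 //.
by rewrite ltrD2r (inj_eq (addIr _)) (gt_eqF fe) ltNge (ltW fe).
Qed.

(* Peel off a maximal set that witnesses the inequality; by laminarity the
   remaining witnesses are disjoint from it. *)
Lemma card_setI_laminar_le (Y X D : {set T}) :
  (forall e, e \in Y -> e \in D -> e \notin X ->
     exists C, [/\ C \in F, e \in C, C \subset D & (#|Y :&: C| <= #|X :&: C|)%N]) ->
  (#|Y :&: D| <= #|X :&: D|)%N.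
Proof.
have [k] := ubnP #|D|; elim: k D => // k IH D; rewrite ltnS => Dk H.
have [YX|/subsetPn[e]] := boolP (Y :&: D \subset X).
  by apply: subset_leq_card; rewrite subsetI YX subsetIr.
rewrite inE => /andP[eY eD] eX; have [C0 [C0F eC0 C0D C0c]] := H e eY eD eX.
pose good (C : {set T}) :=
  [&& C \in F, e \in C, C \subset D & (#|Y :&: C| <= #|X :&: C|)%N].
have g0 : good C0 by apply/and4P.
have [C /and4P[CF eC CD Cc] maxC] := arg_maxnP (fun C : {set T} => #|C|) g0.
have split_card (Z : {set T}) : #|Z :&: D| = (#|Z :&: C| + #|Z :&: (D :\: C)|)%N.
  rewrite -(cardsID C (Z :&: D)) -setIA (setIC D) (setIidPl CD).
  by rewrite setIDA.
rewrite !split_card leq_add // IH //.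
  apply: leq_trans Dk; apply: proper_card; apply/properP; split.
    exact: subsetDl.
  by exists e => //; rewrite inE eC.
move=> f fY; rewrite inE => /andP[fC fD] fX.
have [C' [C'F fC' C'D C'c]] := H f fY fD fX.
exists C'; split=> //; rewrite subsetD C'D /=; apply/contraT => ndis.
have [x xC' xC] : exists2 x, x \in C' & x \in C.
  by move: ndis; rewrite -setI_eq0 => /set0Pn[x /setIP[? ?]]; exists x.
case: (laminarW C'F CF xC' xC) => [/subsetP/(_ _ fC')|CC'].
  by rewrite (negPf fC).
have gC' : good C' by apply/and4P; split => //; apply: (subsetP CC').
have /subset_leqif_cards := CC'; case=> _; rewrite eqn_leq.
have := maxC _ gC'; rewrite /= => ->; rewrite (subset_leq_card CC') /= => /esym/eqP eCC'.
by rewrite eCC' fC' in fC.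
Qed.

(* [j] is not spanned by [G] in the restriction of the matroid to [B]. *)
Definition free (G B : {set T}) (j : T) :=
  (j \in B) &&
  [forall C in F, (j \in C) && (C \subset B) ==> (#|G :&: C| < mu C)%N].

Lemma freeP (G B C : {set T}) j :
  free G B j -> C \in F -> j \in C -> C \subset B -> (#|G :&: C| < mu C)%N.
Proof. by case/andP => _ /forall_inP H /H/implyP + jC CB; rewrite jC CB; apply. Qed.

(** This is the greedy rule: a chosen [j] occupies one more place in each set around it, and an
    omitted [j] has a blocking set already filled by heavier elements. *)
Lemma mem_OPT_free (V B : {set T}) j : B \in F -> j \in V ->
  (j \in OPT F mu w V B) = free (above (OPT F mu w V B) j) B j.
Proof.
set X := OPT F mu w V B => BF jV; apply/idP/idP => [jX|fj].
  have jB : j \in B.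
    by have /subsetP/(_ _ jX) := OPT_sub V B; rewrite inE => /andP[].
  rewrite /free jB; apply/forall_inP => C CF; apply/implyP => /andP[jC CB].
  apply: leq_trans (indepP (OPT_indep V B) CF); rewrite -/X.
  apply/proper_card/properP; split; first exact/setSI/aboveS.
  by exists j; rewrite !inE ?jX ?jC // ltxx andbF.
apply/contraT => jX; have jB : j \in B by case/andP: fj.
have [C [CF jC CB]] := OPT_blocked BF jV jB jX.
by rewrite leqNgt (freeP fj CF jC CB).
Qed.

(** An element above [j] that the optimum of [C] omits lies in a set filled by that optimum above
    [j], where no independent set has more elements. Peeling off these sets gives the bound. *)
Lemma above_OPT_sub (S B C : {set T}) j : C \in F -> C \subset B ->
  (#|above (OPT F mu w S B) j :&: C| <= #|above (OPT F mu w S C) j|)%N.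
Proof.
move=> CF CB; set X := OPT F mu w S C; set Y := OPT F mu w S B.
have XC : above X j \subset C.
  by apply: subset_trans (aboveS _ _) _; rewrite (subset_trans (OPT_sub _ _)) ?subsetIr.
rewrite -(setIidPl XC); apply: card_setI_laminar_le => e.
rewrite inE => /andP[eY je] eC; rewrite inE je andbT => eX.
have eS : e \in S by have /subsetP/(_ _ eY) := OPT_sub S B; rewrite inE => /andP[].
have [D [DF eD DC tD]] := OPT_blocked CF eS eC eX.
exists D; split=> //; apply: (@leq_trans (mu D)).
  apply: indepP => //; apply: indepS (OPT_indep S B); exact: aboveS.
apply: (leq_trans tD); apply/subset_leq_card/setSI/above_mono; exact: ltW.
Qed.

(* As [i] is optimal, no superset of [B] is tight above [i], so the global
   optimum has full rank above [i] inside [B]. *)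
Lemma above_OPT_global (S B : {set T}) i : B \in F -> setT \in F -> i \in B ->
  i \in OPT F mu w setT setT ->
  (#|above (OPT F mu w S B) i| <= #|above (OPT F mu w setT setT) i :&: B|)%N.
Proof.
set O := OPT F mu w setT setT => BF TF iB iO; set Y := OPT F mu w S B.
have YB : above Y i \subset B.
  by apply: subset_trans (aboveS _ _) _; rewrite (subset_trans (OPT_sub _ _)) ?subsetIr.
rewrite -(setIidPl YB); apply: card_setI_laminar_le => e.
rewrite inE => /andP[eY je] eB; rewrite inE je andbT => eO.
have [C [CF eC _ tC]] := OPT_blocked TF (in_setT e) (in_setT e) eO.
have le_ei : (#|above O e :&: C| <= #|above O i :&: C|)%N.
  by apply/subset_leq_card/setSI/above_mono; exact: ltW.
exists C; split=> //.
  case: (laminarW CF BF eC eB) => // BC; exfalso.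
  have : i \in O by [].
  rewrite mem_OPT_free ?in_setT // => fi.
  have := freeP fi CF (subsetP BC _ iB) (subsetT C); rewrite ltnNge.
  by rewrite (leq_trans tC).
apply: leq_trans le_ei; apply: leq_trans tC.
by apply: indepP => //; apply: indepS (OPT_indep S B); exact: aboveS.
Qed.

End LaminarOptimum.

(** * Dynamics of the kicks for a fixed sample *)

Section KickDynamics.
Variables (R : realFieldType) (T : finType) (F : {set {set T}}).
Variables (mu : {set T} -> nat) (w : T -> R).
Hypothesis lamF : laminar F.
Hypothesis mu_mono :
  forall A B, A \in F -> B \in F -> A \proper B -> (mu A < mu B)%N.
Hypothesis w_ge0 : forall x, 0 <= w x.
Hypothesis w_inj : injective w.
Variable S : {set T}.

Let opt B := OPT F mu w S B.

(* The last clause is the parking invariant: below a remaining real slot, and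
   globally, the lost slots are paid for by accepted elements. *)
Definition parking (seen B Rr : {set T}) (d : nat) (Sl : {set T}) : Prop :=
  [/\ Rr \subset opt B, (d <= mu B - #|opt B|)%N,
      forall j, j \in Sl ->
        [/\ j \in seen, j \notin S & free F mu (above w (opt B) j) B j] &
      forall D : {set T},
        D = setT \/ (exists2 x, x \in Rr & D = [set y | w y < w x]) ->
        (#|opt B :&: D| + (mu B - #|opt B|) <= #|Sl :&: D| + #|Rr :&: D| + d)%N].

(* The elements outside [S] and other than [i] that may reach [B] and are
   lighter than all but the last [u] slots of [B]. *)
Definition cars (i : T) (B : {set T}) (u : nat) : {set T} :=
  [set j | [&& j \notin S, j != i, free F mu (above w (opt B) j) B j &
               (mu B - u <= #|above w (opt B) j|)%N]].

Definition admits (B : {set T}) (i : T) := (#|above w (opt B) i| < mu B)%N.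

(** The range of [u] selects the thresholds whose last [u] slots include all slots not above [i],
    dummies among them. *)
Definition unjammed (B : {set T}) (i : T) : Prop :=
  forall u, (mu B - #|above w (opt B) i| <= u <= mu B)%N ->
    (#|cars i B u| < u)%N.

Lemma opt_card (B : {set T}) : B \in F -> (#|opt B| <= mu B)%N.
Proof.
move=> BF; have OB : opt B \subset B by rewrite (subset_trans (OPT_sub _ _ _ _ _)) ?subsetIr.
by rewrite -(setIidPl OB) (indepP (OPT_indep F mu w S B)).
Qed.

Lemma optS (B : {set T}) x : x \in opt B -> x \in S.
Proof. by move=> /(subsetP (OPT_sub F mu w S B)); rewrite inE => /andP[]. Qed.

Lemma parking_init (B : {set T}) : B \in F ->
  parking set0 B (opt B) (mu B - #|opt B|) set0.
Proof.
move=> BF; split=> // [j|D _]; first by rewrite inE.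
by rewrite set0I cards0 add0n.
Qed.

Lemma parkingW (seen seen' B Rr : {set T}) d (Sl : {set T}) :
  seen \subset seen' -> parking seen B Rr d Sl -> parking seen' B Rr d Sl.
Proof.
by move=> ss [h1 h2 h3 h4]; split=> // j /h3[js jS jf]; split=> //; apply: (subsetP ss).
Qed.

Variant kick_spec (i : T) (Rr : {set T}) (d : nat) : option ({set T} * nat) -> Prop :=
| KickReal x of x \in Rr & w x < w i
    & (forall y, y \in Rr -> w y < w i -> w y <= w x) :
    kick_spec i Rr d (Some (Rr :\ x, d))
| KickDummy of (forall y, y \in Rr -> w i <= w y) & (0 < d)%N :
    kick_spec i Rr d (Some (Rr, d.-1))
| KickFail of (forall y, y \in Rr -> w i <= w y) & d = 0%N :
    kick_spec i Rr d None.

Lemma kickP i Rr d : kick_spec i Rr d (kick w i Rr d).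
Proof.
rewrite /kick; set L := [set x in Rr | w x < w i].
case: pickP => [x /andP[]|none].
  rewrite inE => /andP[xR xi] /forall_inP maxx; constructor=> // y yR yi.
  by apply: maxx; rewrite inE yR.
have noL y : y \in Rr -> w i <= w y.
  move=> yR; rewrite leNgt; apply/negP => yi.
  have yL : y \in L by rewrite inE yR.
  have [x xL maxx] := arg_maxP w yL.
  move/negbT/negP: (none x); apply; apply/andP; split=> //; apply/forall_inP => z zL.
  exact: maxx.
by case: d => [|d] /=; constructor.
Qed.

(** Losing [x] matters only below thresholds heavier than [x]. A remaining [y] heavier than [x] is
    also heavier than [i], since [i] kicks the heaviest element below it, so [i] pays for [x]. When
    a dummy goes, all of [Rr] is heavier than [i], and [i] counts at every threshold. *)
Lemma kick_parking (seen B Rr : {set T}) d (Sl : {set T}) i : i \notin S -> i \notin seen ->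
  free F mu (above w (opt B) i) B i -> parking seen B Rr d Sl ->
  forall Rr' d', kick w i Rr d = Some (Rr', d') ->
  parking (i |: seen) B Rr' d' (i |: Sl).
Proof.
move=> iS iseen fi [RX dX solP parkP] Rr' d'.
have iSl : i \notin Sl by apply/negP => /solP[]; rewrite (negPf iseen).
have solP' j : j \in i |: Sl ->
    [/\ j \in i |: seen, j \notin S & free F mu (above w (opt B) j) B j].
  rewrite !inE => /predU1P[->|/solP[js jS jf]]; first by rewrite eqxx.
  by rewrite js orbT.
have RS x : x \in Rr -> x \in S by move=> /(subsetP RX)/optS.
have lt_i x : x \in Rr -> w i <= w x -> w i < w x.
  move=> /RS xS; rewrite le_eqVlt => /predU1P[/w_inj e|//].
  by rewrite e xS in iS.
have cSl (D : {set T}) : #|(i |: Sl) :&: D| = ((i \in D) + #|Sl :&: D|)%N.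
  have [iD|iD] := boolP (i \in D).
    by rewrite setIUl (setIidPl _) ?sub1set // cardsU1 inE (negPf iSl).
  rewrite add0n setIUl (_ : [set i] :&: D = set0) ?set0U //.
  by apply/setP => z; rewrite !inE; apply/negP => /andP[/eqP->]; apply/negP.
case: kickP => [x xR xi maxx|noL d0|//] [<- <-]; split=> //.
- by apply: subset_trans RX; apply: subsetDl.
- move=> D hD; rewrite cSl.
  have /parkP hD' : D = setT \/ exists2 x, x \in Rr & D = [set y | w y < w x].
    case: hD => [->|[y]]; first by left.
    by rewrite inE => /andP[_ yR] ->; right; exists y.
  apply: (leq_trans hD').
  have [xD|xD] := boolP (x \in D); last first.
    rewrite (_ : (Rr :\ x) :&: D = Rr :&: D) ?leq_add2r ?leq_addl //.
    apply/setP => z; rewrite !inE; case: eqP => //= ->.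
    by rewrite (negPf xD) andbF.
  have -> : i \in D.
    case: hD xD => [->|[y]]; first by rewrite inE.
    rewrite inE => /andP[yx yR] ->; rewrite !inE => xy.
    apply: lt_i => //; rewrite leNgt; apply/negP => /(maxx _ yR).
    by rewrite leNgt xy.
  have := cardsD1 x (Rr :&: D); rewrite inE xR xD setIDAC => ->.
  by rewrite addnCA addnA.
- by rewrite (leq_trans (leq_pred d)).
- move=> D hD; rewrite cSl; apply: (leq_trans (parkP D hD)).
  have -> : i \in D.
    case: hD => [->|[y yR ->]]; first by rewrite inE.
    by rewrite inE lt_i // noL.
  by rewrite -{1}(prednK d0) addnS add1n !addSn.
Qed.

Lemma kick_admits (seen B Rr : {set T}) d (Sl : {set T}) i : B \in F -> parking seen B Rr d Sl ->
  kick w i Rr d -> admits B i.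
Proof.
move=> BF [RX dX _ _]; rewrite /admits; have cX := opt_card BF.
case: kickP => // [x xR xi _ _|_ d0 _].
  apply: leq_trans cX; apply/proper_card/properP; split; first exact: aboveS.
  by exists x; rewrite ?(subsetP RX) // !inE ltNge (ltW xi) andbF.
apply: leq_ltn_trans (subset_leq_card (aboveS w (opt B) i)) _.
by rewrite -subn_gt0 (leq_trans d0).
Qed.

(** On failure no dummy is left and all of [Rr] is heavier than [i]. Take the lightest remaining [x]
    as threshold: all [u] slots below it are lost, so the invariant yields [u] accepted elements
    below [x], and these are cars. If [Rr] is empty, the threshold is [u = mu B]. *)
Lemma kick_fail_jam (seen B Rr : {set T}) d (Sl : {set T}) i : B \in F -> i \notin S -> i \notin seen ->
  parking seen B Rr d Sl -> kick w i Rr d = None -> ~ unjammed B i.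
Proof.
move=> BF iS iseen [RX _ solP parkP]; have cX := opt_card BF.
case: kickP => // noL d0 _; rewrite {}d0 in parkP.
have carSol u j : (mu B - u <= #|above w (opt B) j|)%N -> j \in Sl -> j \in cars i B u.
  move=> uj /solP[js jS jf]; rewrite inE jS jf uj /= andbT.
  by apply/eqP => e; rewrite -e js in iseen.
have [R0|[x1 x1R]] := set_0Vmem Rr.
  move=> /(_ (mu B)); rewrite leq_subr leqnn => /(_ isT); apply/negP; rewrite -leqNgt.
  have := parkP setT (or_introl erefl); rewrite !setIT R0 cards0 !addn0 subnKC //.
  move=> /leq_trans; apply; apply/subset_leq_card/subsetP => j.
  by apply: carSol; rewrite subnn.
have [x xR minx] := arg_minP w x1R.
pose D := [set y | w y < w x].
pose u := (#|opt B :&: D| + (mu B - #|opt B|))%N.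
have ucar : (mu B - u)%N = #|opt B :\: D|.
  by rewrite /u; have := cardsID D (opt B); move: cX; clear; lia.
have uD j : w j < w x -> (mu B - u <= #|above w (opt B) j|)%N.
  move=> jx; rewrite ucar; apply/subset_leq_card/subsetP => y.
  by rewrite !inE -leNgt => /andP[xy ->]; apply: lt_le_trans xy.
have ix : w i < w x.
  rewrite lt_neqAle noL // andbT; apply/eqP => /w_inj e.
  by move: iS; rewrite e (optS (subsetP RX _ xR)).
move=> /(_ u); rewrite leq_subCl uD //=.
suff [uB cu] : (u <= mu B)%N /\ (u <= #|cars i B u|)%N.
  by rewrite uB => /(_ isT); rewrite ltnNge cu.
split.
  have : (#|opt B :&: D| <= #|opt B|)%N by rewrite subset_leq_card // subsetIl.
  by rewrite /u; move: cX; clear; lia.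
have := parkP D (or_intror (ex_intro2 (fun z => z \in Rr) (fun z => D = [set y | w y < w z]) x xR erefl)).
rewrite (_ : Rr :&: D = set0) ?cards0 ?addn0; last first.
  by apply/setP => y; rewrite !inE; apply/negP => /andP[/minx]; rewrite /= leNgt => /negP.
move=> /leq_trans; apply; apply/subset_leq_card/subsetP => j.
by rewrite !inE => /andP[jSl jx]; have := carSol u j (uD j jx) jSl; rewrite inE.
Qed.

Definition state_parking (seen : {set T}) (st : state T) (B : {set T}) :=
  parking seen B (Rreal st B) (Rdummy st B) (Sol st B).

Lemma Sol_visit i ch st B : Sol st B \subset Sol (visit w i ch st) B.
Proof.
elim: ch st => [|C ch IH] st //=; case: (kick _ _ _ _) => [[Rr d]|//].
apply: subset_trans (IH _); rewrite /upd /=; case: eqP => [->|//].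
exact: subsetUr.
Qed.

Lemma Sol_process s st B : Sol st B \subset Sol (process F w s st) B.
Proof.
elim: s st => [|i s IH] st //=.
by apply: subset_trans (IH _); apply: Sol_visit.
Qed.

(** The induction runs over the rest [ch] of the chain. Members around [i] outside [ch] have already
    been kicked, so they admit [i]; members on [ch] have not yet seen [i]. *)
Lemma visit_parking i ch (seen : {set T}) st : i \notin S -> i \notin seen ->
  pairwise (fun A B : {set T} => A \subset B) ch -> uniq ch ->
  (forall B, B \in ch -> (B \in F) && (i \in B)) ->
  (forall C, C \in F -> i \in C -> C \notin ch -> admits C i) ->
  (forall B, B \in F -> state_parking (if B \in ch then seen else i |: seen) st B) ->
  (forall B, B \in F -> state_parking (i |: seen) (visit w i ch st) B) /\
  ((forall B, B \in ch -> unjammed B i) ->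
    forall B, B \in ch -> i \in Sol (visit w i ch st) B).
Proof.
move=> iS iseen; elim: ch st => [|B ch IH] st /=; first by move=> _ _ _ _ H; split.
move=> /andP[Bch pch] /andP[nBch uch] chF adm inv.
have /andP[BF iB] := chF B (mem_head _ _).
have pB : state_parking seen st B by have := inv B BF; rewrite inE eqxx.
case E : (kick w i (Rreal st B) (Rdummy st B)) => [[Rr d]|]; last first.
  split=> [C CF|H]; last first.
    by have := H B (mem_head _ _) => /(kick_fail_jam BF iS iseen pB E).
  by have := inv C CF; case: ifP => // _; apply: parkingW; apply: subsetUr.
have aB : admits B i by apply: kick_admits pB _ => //; rewrite E.
(* A member around [i] inside [B] is [B] itself or was passed before; it admits [i], and
   [above_OPT_sub] transfers this to the optimum of [B]. *)
have fB : free F mu (above w (opt B) i) B i.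
  rewrite /free iB; apply/forall_inP => C CF; apply/implyP => /andP[iC CB].
  apply: leq_ltn_trans (above_OPT_sub lamF mu_mono w_ge0 w_inj _ _ CF CB) _.
  have [CBch|/(adm C CF iC)//] := boolP (C \in B :: ch).
  suff -> : C = B by [].
  move: CBch; rewrite inE => /predU1P[//|Cch].
  by apply/eqP; rewrite eqEsubset CB (allP Bch).
have [C Cch|C CF iC Cch|C CF|H1 H2] := IH (upd st B Rr d i) pch uch.
- by apply: chF; rewrite inE Cch orbT.
- have [->//|CB] := eqVneq C B.
  by apply: adm; rewrite // inE (negPf CB).
- rewrite /state_parking /upd /=; have [->|CB] := eqVneq C B.
    by rewrite (negPf nBch); apply: kick_parking E.
  by have := inv C CF; rewrite inE (negPf CB).
split=> // H C; rewrite inE => /predU1P[->|Cch]; last first.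
  by apply: H2 => // D Dch; apply: H; rewrite inE Dch orbT.
by apply: (subsetP (Sol_visit _ _ _ _)); rewrite /upd /= eqxx setU11.
Qed.

Lemma chain_spec i :
  [/\ pairwise (fun A B : {set T} => A \subset B) (chain F i), uniq (chain F i) &
      forall B, (B \in chain F i) = (B \in F) && (i \in B)].
Proof.
have memc B : (B \in chain F i) = (B \in F) && (i \in B).
  by rewrite mem_sort mem_filter mem_enum andbC.
split=> //; last by rewrite sort_uniq filter_uniq // enum_uniq.
have tr : transitive (fun A B : {set T} => A \subset B).
  by move=> B A C; apply: subset_trans.
rewrite -sorted_pairwise //.
(* Inclusion is a total relation only among the members that contain [i]. *)
apply: (@sort_sorted_in _ [pred B : {set T} | (B \in F) && (i \in B)]).
  move=> A B /andP[AF iA] /andP[BF iB].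
  by apply/orP; case: (laminarW lamF AF BF iA iB) => ->; [left|right].
by apply/allP => B; rewrite mem_filter mem_enum andbC.
Qed.

Lemma visit_chain i (seen : {set T}) st : i \notin S -> i \notin seen ->
  (forall B, B \in F -> state_parking seen st B) ->
  (forall B, B \in F -> state_parking (i |: seen) (visit w i (chain F i) st) B) /\
  ((forall B, B \in F -> i \in B -> unjammed B i) ->
    forall B, B \in F -> i \in B -> i \in Sol (visit w i (chain F i) st) B).
Proof.
move=> iS iseen inv; have [pc uc mc] := chain_spec i.
have [B|C CF iC|B BF|H1 H2] := visit_parking iS iseen pc uc (st := st).
- by rewrite mc.
- by rewrite mc CF iC.
- by case: ifP => _; [exact: inv|apply: parkingW (inv B BF); apply: subsetUr].
split=> // H B BF iB; apply: H2; last by rewrite mc BF.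
by move=> C; rewrite mc => /andP[]; apply: H.
Qed.

(** [unjammed] depends on the sample alone, so it persists through the arrivals before [i]. *)
Lemma process_Sol s (seen : {set T}) st i : setT \in F -> uniq s ->
  (forall j, j \in s -> (j \notin S) && (j \notin seen)) ->
  (forall B, B \in F -> state_parking seen st B) ->
  (forall B, B \in F -> i \in B -> unjammed B i) ->
  i \in s -> i \in Sol (process F w s st) setT.
Proof.
move=> TF + + + H; elim: s seen st => [|j s IH] seen st //= /andP[js us] fresh inv.
have /andP[jS jseen] := fresh j (mem_head _ _).
have [inv' jSol] := visit_chain jS jseen inv.
rewrite inE => /predU1P[eij|]; last first.
  apply: IH inv' => // k ks; have /andP[kS kseen] : (k \notin S) && (k \notin seen) by rewrite fresh // inE ks orbT.
  rewrite kS !inE negb_or kseen andbT; apply/eqP => e.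
  by rewrite -e ks in js.
apply: (subsetP (Sol_process _ _ _)); rewrite eij; apply: jSol; rewrite ?in_setT //.
by rewrite -eij.
Qed.

Lemma KickNext_accepts s i : setT \in F -> uniq s -> {subset s <= ~: S} ->
  (forall B, B \in F -> i \in B -> unjammed B i) ->
  i \in s -> i \in Sol (process F w s (init_state F mu w S)) setT.
Proof.
move=> TF us sS; apply: (process_Sol TF (seen := set0)) => //.
  by move=> j /sS; rewrite !inE => ->.
by move=> B BF; apply: parking_init.
Qed.

End KickDynamics.

(** * Independent samples and the ruin walk *)

Section CoinFlips.
Variables (R : realFieldType) (p q : R).
Hypotheses (p_ge0 : 0 <= p) (q_ge0 : 0 <= q) (pq1 : q + p = 1).

(** For a duplicate-free [l], the expectation of [phi] at a random subset of [l] with inclusion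
    probability [q]. The coins are revealed in the order of [l], which makes induction along a scan
    possible. *)
Fixpoint flips (T : finType) (l : seq T) (phi : {set T} -> R) : R :=
  if l is x :: l' then q * flips l' (fun S => phi (x |: S)) + p * flips l' phi
  else phi set0.

Lemma eq_flips (T : finType) (l : seq T) (phi psi : {set T} -> R) :
  (forall S : {set T}, {subset S <= l} -> phi S = psi S) ->
  flips l phi = flips l psi.
Proof.
elim: l phi psi => [|x l IH] phi psi H /=.
  by apply: H => x; rewrite inE.
congr (_ * _ + _ * _); apply: IH => S Sl; apply: H => y.
  by rewrite !inE => /predU1P[->|/Sl->]; rewrite ?eqxx ?orbT.
by move=> /Sl yl; rewrite inE yl orbT.
Qed.

Lemma flips_const (T : finType) (l : seq T) (c : R) : flips l (fun=> c) = c.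
Proof. by elim: l => //= x l ->; rewrite -mulrDl pq1 mul1r. Qed.

Lemma flips_sum (T : finType) (l : seq T) (phi : {set T} -> R) : uniq l ->
  flips l phi = \sum_(S : {set T} | S \subset [set x in l])
    q ^+ #|S| * p ^+ (size l - #|S|) * phi S.
Proof.
elim: l phi => [|x l IH] phi /=.
  move=> _; rewrite (big_pred1 set0) ?cards0 ?expr0 ?mul1r // => S.
  by rewrite /= -subset0; congr (_ \subset _); apply/setP => y; rewrite !inE.
move=> /andP[xl ul]; rewrite !IH // [RHS](bigID (fun S : {set T} => x \in S)) /=.
have lx : x \notin [set y in l] by rewrite inE.
congr (_ + _).
  rewrite [RHS](reindex_onto (fun S => x |: S) (fun S => S :\ x)) /=; last first.
    by move=> S /andP[_ xS]; rewrite setD1K.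
  rewrite mulr_sumr; apply: eq_big => S.
    rewrite setU11 andbT subUset sub1set inE mem_head /=.
    apply/idP/andP => [Sl|[Sl /eqP e]].
      have xS : x \notin S by apply: contra lx; apply: (subsetP Sl).
      split; last by rewrite setU1K.
      by apply: (subset_trans Sl); apply/subsetP => y; rewrite !inE => ->; rewrite orbT.
    have xS : x \notin S by rewrite -e !inE eqxx.
    apply/subsetP => y yS; have := subsetP Sl _ yS; rewrite !inE.
    by case: eqP => // eyx; rewrite -eyx yS in xS.
  move=> Sl; have xS : x \notin S by apply: contra lx; apply: (subsetP Sl).
  by rewrite cardsU1 xS add1n subSS exprS !mulrA.
rewrite mulr_sumr; apply: eq_big => S.
  apply/idP/andP => [Sl|[Sl xS]].
    split; last by apply: contra lx; apply: (subsetP Sl).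
    by apply: (subset_trans Sl); apply/subsetP => y; rewrite !inE => ->; rewrite orbT.
  apply/subsetP => y yS; have := subsetP Sl _ yS; rewrite !inE.
  by case: eqP => // eyx; rewrite -eyx yS in xS.
move=> Sl; have cS : (#|S| <= size l)%N.
  by apply: leq_trans (subset_leq_card Sl) _; rewrite cardsE; apply: card_size.
by rewrite subSn // exprS; ring.
Qed.

(** The coin of [i] is flipped first: success annihilates the integrand, failure contributes the
    factor [p]. *)
Lemma flips_avoid (T : finType) (i : T) l (phi : {set T} -> R) :
  uniq (i :: l) -> (forall x, x \in i :: l) ->
  \sum_(S : {set T}) q ^+ #|S| * p ^+ (#|T| - #|S|) * ((i \notin S)%:R * phi S) =
  p * flips l phi.
Proof.
move=> uil full.
have fullT : [set x in i :: l] = setT by apply/setP => x; rewrite !inE -in_cons full.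
have -> : #|T| = size (i :: l).
  by rewrite -cardsT -fullT cardsE (card_uniqP uil).
have := flips_sum (fun S => (i \notin S)%:R * phi S) uil; rewrite fullT.
under [X in _ = X -> _]eq_bigl do rewrite subsetT.
move=> <- /=; rewrite (eq_flips (psi := fun=> 0)); last first.
  by move=> S _; rewrite setU11 mul0r.
rewrite flips_const mulr0 add0r; congr (_ * _); apply: eq_flips => S Sl.
rewrite (_ : i \notin S) ?mul1r //; apply/negP => /Sl.
by case/andP: uil => /negPf->.
Qed.

Lemma miss_probability (T : finType) (i : T) :
  \sum_(S : {set T}) q ^+ #|S| * p ^+ (#|T| - #|S|) * (i \notin S)%:R = p.
Proof.
have := @flips_avoid T i (enum (setT :\ i)) (fun=> 1).
rewrite flips_const mulr1 => avoid; rewrite -[RHS]avoid /=.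
- by apply: eq_bigr => S _; rewrite mulr1.
- by rewrite mem_enum !inE eqxx enum_uniq.
- by move=> x; rewrite inE mem_enum !inE andbT orbN.
Qed.

(* [ruin x y] is the probability that [x] failures precede [y] successes. *)
Fixpoint ruin (x : nat) : nat -> R :=
  if x is x'.+1 then
    fix ruin_x y := if y is y'.+1 then p * ruin x' y + q * ruin_x y' else 0
  else fun=> 1.

Lemma ruin0 y : ruin 0 y = 1. Proof. by []. Qed.

Lemma ruinS0 x : ruin x.+1 0 = 0. Proof. by []. Qed.

Lemma ruinSS x y : ruin x.+1 y.+1 = p * ruin x y.+1 + q * ruin x.+1 y.
Proof. by []. Qed.

Lemma ruin_ge0 x y : 0 <= ruin x y.
Proof.
elim: x y => [|x IHx] y; first by rewrite ruin0 ler01.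
by elim: y => [|y IHy] //; rewrite ruinSS addr_ge0 // mulr_ge0.
Qed.

Section Walk.
Variables (T : finType) (F : {set {set T}}) (mu : {set T} -> nat) (w : T -> R).
Hypothesis lamF : laminar F.
Hypothesis mu_mono :
  forall A B, A \in F -> B \in F -> A \proper B -> (mu A < mu B)%N.
Hypothesis w_ge0 : forall x, 0 <= w x.
Hypothesis w_inj : injective w.
Variables (B : {set T}) (u : nat).
Hypotheses (BF : B \in F) (uB : (u <= mu B)%N).

(** An online count of the cars: [G] holds the slots found so far and decides whether [j] is free;
    the coin of [j] then makes it a slot or a car. Cars count only once [mu B - u] slots are
    found. *)
Fixpoint greedy_cars (l : seq T) (S G : {set T}) : nat :=
  if l is j :: l' then
    if free F mu G B j then
      if j \in S then greedy_cars l' S (j |: G)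
      else ((mu B - u <= #|G|) + greedy_cars l' S G)%N
    else greedy_cars l' S G
  else 0%N.

Lemma greedy_carsU1 x l (S G : {set T}) : x \notin l ->
  greedy_cars l (x |: S) G = greedy_cars l S G.
Proof.
elim: l G => [|j l IH] G //=; rewrite inE negb_or => /andP[xj xl].
by rewrite in_setU1 eq_sym (negPf xj) /= !IH.
Qed.

Lemma free_card_lt (G : {set T}) j : G \subset B -> free F mu G B j ->
  (#|G| < mu B)%N.
Proof.
move=> GB fj; rewrite -(setIidPl GB); apply: (freeP fj) => //.
by case/andP: fj.
Qed.

(** Now every free element counts and is one step of the walk: a car with probability [p], a slot
    with probability [q]. At most [mu B - #|G|] further slots exist; elements that are not free make
    no step. *)
Lemma late_walk l (G : {set T}) x : uniq l -> G \subset B ->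
  (forall j, j \in l -> j \notin G) -> (mu B - u <= #|G|)%N ->
  flips l (fun S => (x <= greedy_cars l S G)%N%:R) <= ruin x (mu B - #|G|).
Proof.
elim: l G x => [|j l IH] G [|x].
- by move=> *; rewrite ruin0.
- by move=> *; apply: ruin_ge0.
- by move=> *; rewrite (eq_flips (psi := fun=> 1)) // flips_const ruin0.
move=> /andP[jl ul] GB lG uG.
have lG' k : k \in l -> k \notin G by move=> kl; apply: lG; rewrite inE kl orbT.
have [fj|nfj] := boolP (free F mu G B j); last first.
  rewrite [flips _ _]/= (negPf nfj).
  rewrite (eq_flips (psi := fun S => (x.+1 <= greedy_cars l S G)%N%:R)); last first.
    by move=> S _; rewrite greedy_carsU1.
  by rewrite -mulrDl pq1 mul1r; apply: IH.
have GmuB := free_card_lt GB fj.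
have cG : #|j |: G| = #|G|.+1 by rewrite cardsU1 lG ?mem_head.
have jB : j \in B by case/andP: fj.
rewrite (_ : mu B - #|G| = (mu B - #|j |: G|).+1)%N; last by rewrite cG subnSK.
rewrite ruinSS addrC [flips _ _]/= fj; apply: lerD; apply: ler_wpM2l => //; last first.
  rewrite cG subnSK //.
  rewrite (eq_flips (psi := fun S => (x <= greedy_cars l S G)%N%:R)); first exact: IH.
  move=> S Sl; case: ifP => [/Sl|_]; first by rewrite (negPf jl).
  by rewrite uG.
rewrite (eq_flips (psi := fun S => (x.+1 <= greedy_cars l S (j |: G))%N%:R)).
  apply: IH => //; first by rewrite subUset sub1set jB.
    move=> k kl; rewrite !inE negb_or lG' // andbT.
    by apply/eqP => e; rewrite -e kl in jl.
  by rewrite cG (leq_trans uG).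
by move=> S Sl; rewrite setU11 greedy_carsU1.
Qed.

(** Until [mu B - u] slots are found no car counts, so both outcomes of a coin keep the same bound
    [ruin u u]; then [late_walk] takes over with [u] slots left. *)
Lemma early_walk l (G : {set T}) : uniq l -> G \subset B ->
  (forall j, j \in l -> j \notin G) -> (#|G| <= mu B - u)%N ->
  flips l (fun S => (u <= greedy_cars l S G)%N%:R) <= ruin u u.
Proof.
elim: l G => [|j l IH] G /=.
  by move=> *; case: (u) => // v; apply: ruin_ge0.
move=> /andP[jl ul] GB lG; rewrite leq_eqVlt => /predU1P[eG|Gu].
  have uG : (mu B - u <= #|G|)%N by rewrite eG.
  have := @late_walk (j :: l) G u _ GB lG uG; rewrite /= jl ul eG subKn //.
  by move=> /(_ isT).
have lG' k : k \in l -> k \notin G by move=> kl; apply: lG; rewrite inE kl orbT.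
have [fj|nfj] := boolP (free F mu G B j); last first.
  rewrite (eq_flips (psi := fun S => (u <= greedy_cars l S G)%N%:R)); last first.
    by move=> S _; rewrite greedy_carsU1.
  by rewrite -mulrDl pq1 mul1r; apply: IH => //; apply: ltnW.
have jB : j \in B by case/andP: fj.
have -> : ruin u u = q * ruin u u + p * ruin u u by rewrite -mulrDl pq1 mul1r.
apply: lerD; apply: ler_wpM2l => //.
  rewrite (eq_flips (psi := fun S => (u <= greedy_cars l S (j |: G))%N%:R)).
    apply: IH => //; first by rewrite subUset sub1set jB.
      move=> k kl; rewrite !inE negb_or lG' // andbT.
      by apply/eqP => e; rewrite -e kl in jl.
    by rewrite cardsU1 lG ?mem_head.
  by move=> S Sl; rewrite setU11 greedy_carsU1.
rewrite (eq_flips (psi := fun S => (u <= greedy_cars l S G)%N%:R)).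
  by apply: IH => //; apply: ltnW.
move=> S Sl; case: ifP => [/Sl|_]; first by rewrite (negPf jl).
by rewrite [(_ - _ <= _)%N]leqNgt Gu add0n.
Qed.

(** In a scan by decreasing weight, the slots found before [j] are exactly the optimal elements
    above [j], and [mem_OPT_free] decides whether a sampled [j] joins them. *)
Lemma cars_greedy (S : {set T}) i l : i \notin l ->
  pairwise (fun x y => w y < w x) l ->
  (forall x j, x \in OPT F mu w S B -> x \notin l -> j \in l -> w j < w x) ->
  #|cars F mu w S i B u :&: [set x in l]| =
  greedy_cars l S (OPT F mu w S B :\: [set x in l]).
Proof.
set X := OPT F mu w S B; elim: l => [|j l IH] /=.
  by move=> *; apply/eqP; rewrite cards_eq0; apply/eqP/setP => x; rewrite !inE andbF.
rewrite inE negb_or => /andP[ij il] /andP[jl pl] up.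
have jnl : j \notin l by apply/negP => /(allP jl); rewrite ltxx.
have Gj : X :\: [set x in j :: l] = above w X j.
  apply/setP => x; rewrite !inE negb_or; have [xX|] := boolP (x \in X); rewrite ?andbF //.
  rewrite andbT /=; apply/andP/idP => [[xj xl]|jx].
    by apply: up; rewrite ?mem_head // inE negb_or xj.
  split; first by apply/eqP => e; rewrite e ltxx in jx.
  by apply/negP => /(allP jl); rewrite ltNge (ltW jx).
have up' x k : x \in X -> x \notin l -> k \in l -> w k < w x.
  move=> xX xl kl; have [->|xj] := eqVneq x j; first exact: (allP jl).
  by apply: up => //; rewrite inE ?negb_or ?xj // kl orbT.
have IH' := IH il pl up'.
have card_cons : #|cars F mu w S i B u :&: [set x in j :: l]| =
    ((j \in cars F mu w S i B u) + #|cars F mu w S i B u :&: [set x in l]|)%N.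
  rewrite (cardsD1 j) 3!inE mem_head andbT; congr (_ + #|pred_of_set _|)%N.
  apply/setP => x; rewrite !inE; have [->|] := eqVneq x j; last by [].
  by rewrite (negPf jnl) andbF.
rewrite card_cons IH' inE (eq_sym j) ij /= Gj.
have GlX : j \notin X -> X :\: [set x in l] = above w X j.
  move=> jX; rewrite -Gj; apply/setP => x; rewrite !inE negb_or.
  by have [->|] := eqVneq x j; rewrite ?(negPf jX) ?andbF.
have [jS|jS] := boolP (j \in S) => /=; last first.
  have -> : X :\: [set x in l] = above w X j.
    by apply: GlX; apply: contra jS => /(subsetP (OPT_sub _ _ _ _ _)); rewrite inE => /andP[].
  by case: (free _ _ _ _ _).
rewrite add0n -(mem_OPT_free lamF mu_mono w_ge0 w_inj BF jS).
have [jX|/GlX->//] := boolP (j \in X).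
rewrite -Gj; congr greedy_cars; apply/setP => x; rewrite !inE.
by have [->|] := eqVneq x j; rewrite ?jX ?jnl.
Qed.

Lemma jam_probability i :
  \sum_(S : {set T}) q ^+ #|S| * p ^+ (#|T| - #|S|) *
    ((i \notin S) && (u <= #|cars F mu w S i B u|)%N)%:R <= p * ruin u u.
Proof.
pose leT x y := w y <= w x.
pose l := sort leT (enum (setT :\ i)).
have memlE x : (x \in l) = (x != i) by rewrite mem_sort mem_enum !inE andbT.
have ul : uniq l by rewrite sort_uniq enum_uniq.
have il : i \notin l by rewrite memlE eqxx.
have pl : pairwise (fun x y => w y < w x) l.
  have : pairwise leT l.
    rewrite -sorted_pairwise; last by move=> y x z xy yz; apply: le_trans xy.
    by apply: sort_sorted => x y; apply: le_total.
  move=> ple; have := uniq_pairwise l; rewrite ul => /esym pne.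
  have : pairwise [rel x y | leT x y && (x != y)] l by rewrite pairwise_relI ple.
  apply: sub_pairwise => x y /= /andP[xy nxy]; rewrite lt_neqAle.
  apply/andP; split; last exact: xy.
  by apply: contra nxy => /eqP/w_inj->.
rewrite (eq_bigr (fun S : {set T} => q ^+ #|S| * p ^+ (#|T| - #|S|) *
  ((i \notin S)%:R * (u <= #|cars F mu w S i B u|)%N%:R))); last first.
  by move=> S _; rewrite -natrM mulnb.
rewrite (flips_avoid (l := l)) /= ?il //; last first.
  by move=> x; rewrite inE memlE orbN.
apply: ler_wpM2l => //.
rewrite (eq_flips (psi := fun S => (u <= greedy_cars l S set0)%N%:R)).
  by apply: early_walk => // [|j _|]; rewrite ?sub0set ?cards0 // inE.
move=> S Sl.
have l0 x : x \notin l -> x \notin OPT F mu w S B.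
  apply: contra => /(subsetP (OPT_sub _ _ _ _ _)); rewrite inE => /andP[xS _].
  exact: Sl.
have := @cars_greedy S i l il pl; rewrite (_ : _ :\: _ = set0); last first.
  apply/setP => x; rewrite !inE; apply/negP => /andP[/l0/negP].
  by apply.
rewrite (setIidPl _); first by move=> -> // x j + /l0/negP.
by apply/subsetP => x; rewrite !inE memlE => /and4P[].
Qed.

End Walk.

End CoinFlips.

Arguments ruin : simpl never.

(** * Counting pairs of an optimal element and a member by slack *)

Section SlackCounting.

(* Contract one point of a minimal member: this merges no two of the other
   members. *)
Lemma laminar_card_le (T : finType) (P : {set {set T}}) (Q : {set T}) :
  laminar P -> (forall A, A \in P -> A \subset Q /\ (1 < #|A|)%N) ->
  (#|P| <= #|Q|)%N.
Proof.
have [k] := ubnP #|Q|; elim: k P Q => // k IH P Q; rewrite ltnS => Qk lamP H.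
have [->|[A0 A0P]] := set_0Vmem P; first by rewrite cards0.
have [A AP minA] := arg_minnP (fun A : {set T} => #|A|) A0P.
have {A0 A0P} AP : A \in P := AP.
have [AQ A1] := H A AP; have /card_gt1P[x [y [xA yA xy]]] := A1.
pose P' := [set B :\ x | B in P :\ A].
have xQ : x \in Q by apply: (subsetP AQ).
(* Another member that meets the minimal [A] contains it properly. So it contains both or neither of
   [x] and [y], and it keeps two points when [x] is removed. *)
have key B : B \in P -> B != A -> forall z, z \in A -> z \in B -> A \proper B.
  move=> BP BA z zA zB; case: (laminarW lamP AP BP zA zB) => [AB|BA'].
    by rewrite properEneq eq_sym BA AB.
  by move: BA; rewrite eqEcard BA' (minA B BP).
have cP' : #|P'| = #|P|.-1.
  rewrite (cardsD1 A P) AP add1n /=; apply: card_in_imset => B C.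
  rewrite !inE => /andP[BA BP] /andP[CA CP] e.
  suff xBC : (x \in B) = (x \in C).
    apply/setP => z; have [->//|zx] := eqVneq z x.
    by move/setP/(_ z): e; rewrite !inE zx.
  have yBC : (y \in B) = (y \in C).
    by move/setP/(_ y): e; rewrite !inE eq_sym xy.
  have sub D : D \in P -> D != A -> (x \in D) = (y \in D).
    move=> DP DA; apply/idP/idP => zD.
      exact: (subsetP (proper_sub (key D DP DA x xA zD))).
    exact: (subsetP (proper_sub (key D DP DA y yA zD))).
  by rewrite !sub.
have P'k : (#|P'| <= #|Q :\ x|)%N.
  apply: IH.
  - by apply: leq_trans Qk; rewrite [X in (_ < X)%N](cardsD1 x) xQ.
  - apply/forall_inP => _ /imsetP[B /setD1P[_ BP] ->].
    apply/forall_inP => _ /imsetP[C /setD1P[_ CP] ->].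
    move/forall_inP: lamP => /(_ B BP)/forall_inP/(_ C CP)/or3P[BC|CB|dis].
    + by rewrite (setSD _ BC).
    + by rewrite (setSD _ CB) orbT.
    + rewrite (disjointWl (subsetDl _ _)) ?orbT //.
      by rewrite (disjointWr (subsetDl _ _)).
  - move=> _ /imsetP[B /setD1P[BA BP] ->]; have [BQ B1] := H B BP.
    split; first by apply: setSD.
    have [xB|xB] := boolP (x \in B); last first.
      by rewrite (setDidPl _) // disjoint_sym disjoints1.
    have := proper_card (key B BP BA x xA xB).
    by rewrite [X in (_ < X)%N](cardsD1 x) xB add1n ltnS; apply: leq_trans.
move: P'k; rewrite cP' (cardsD1 x Q) xQ add1n (cardsD1 A P) AP add1n /=.
by [].
Qed.

(** Subtract the minimal weight [w x] from all weights: its coefficient is the full sum of [g], the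
    hypothesis at [x], and the remaining weights live on [O :\ x] with the same order. *)
Lemma abel_sum_le0 (R : realFieldType) (T : finType) (w g : T -> R) (O : {set T}) :
  injective w -> (forall x, x \in O -> 0 <= w x) ->
  (forall x, x \in O -> \sum_(i in O | w x <= w i) g i <= 0) ->
  \sum_(i in O) w i * g i <= 0.
Proof.
have [k] := ubnP #|O|; elim: k O w => // k IH O w; rewrite ltnS => Ok wI w0 H.
have [->|[x1 x1O]] := set_0Vmem O; first by rewrite big_set0.
have [x xO minx] := arg_minP w x1O; have {x1 x1O}xO : x \in O := xO.
have minO i : i \in O -> w x <= w i by move=> iO; apply: minx.
have -> : \sum_(i in O) w i * g i =
    w x * \sum_(i in O) g i + \sum_(i in O :\ x) (w i - w x) * g i.
  rewrite mulr_sumr (big_setD1 x) //= [X in _ = X + _](big_setD1 x) //= -addrA.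
  by congr (_ + _); rewrite -big_split /=; apply: eq_bigr => i _; ring.
rewrite -[leRHS]addr0; apply: lerD.
  rewrite mulr_ge0_le0 ?w0 //; apply: le_trans (H x xO).
  rewrite le_eqVlt; apply/orP; left; apply/eqP/eq_bigl => i.
  by have [/minO->|] := boolP (i \in O).
apply: (IH (O :\ x) (fun i => w i - w x)).
- by apply: leq_trans Ok; rewrite [X in (_ < X)%N](cardsD1 x) xO.
- by move=> i j /addIr/wI.
- by move=> i /setD1P[_ iO]; rewrite subr_ge0 minO.
- move=> y /setD1P[yx yO]; apply: le_trans (H y yO).
  rewrite le_eqVlt; apply/orP; left; apply/eqP/eq_bigl => i.
  rewrite lerD2r !inE; have [->|//] := eqVneq i x.
  rewrite xO /=; apply/esym/negbTE; rewrite -ltNge lt_neqAle minO // andbT.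
  by apply: contra yx => /eqP/wI->.
Qed.

Variables (R : realFieldType) (T : finType) (F : {set {set T}}).
Variables (mu : {set T} -> nat) (w : T -> R).
Hypothesis lamF : laminar F.
Hypothesis mu_mono :
  forall A B, A \in F -> B \in F -> A \proper B -> (mu A < mu B)%N.
Hypothesis w_ge0 : forall x, 0 <= w x.
Hypothesis w_inj : injective w.
Variable O : {set T}.
Hypothesis indepO : indep F mu O.

(** Members through [x] form a chain, on which [mu] is injective. *)
Lemma card_chain_le (Phi : {set {set T}}) x a b : Phi \subset F ->
  (forall B, B \in Phi -> (x \in B) && (a <= mu B < a + b)%N) -> (#|Phi| <= b)%N.
Proof.
move=> PF H; rewrite cardE -(size_map mu) -[b](size_iota a).
apply: uniq_leq_size.
  rewrite map_inj_in_uniq ?enum_uniq // => B C; rewrite !mem_enum => BP CP e.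
  have /andP[xB _] := H B BP; have /andP[xC _] := H C CP.
  have [BF CF] := (subsetP PF B BP, subsetP PF C CP).
  apply/eqP/contraT => BC.
  case: (laminarW lamF BF CF xB xC) => BC'.
    by have := mu_mono BF CF; rewrite properEneq BC BC' e ltnn => /(_ isT).
  by have := mu_mono CF BF; rewrite properEneq eq_sym BC BC' e ltnn => /(_ isT).
by move=> m /mapP[B]; rewrite mem_enum => /H /andP[_ +] ->; rewrite mem_iota.
Qed.

(** Group the members by their trace [P] on [Q]. Since [Q] is an upper set of [O], the elements of
    [O] above [i] in [B] lie in [P] without [i], so [mu B < #|P| + s]; also [mu B] is at least
    [#|P|] and at least [s]. This leaves [s] capacities, or one if [P] is a singleton. *)
Lemma card_slack_sets (Q : {set T}) s :
  Q \subset O -> (forall i j, i \in Q -> j \in O -> w i <= w j -> j \in Q) ->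
  (#|[set B in F | [exists i in Q, (i \in B) &&
       (#|above w O i :&: B| + s == mu B)%N]]| <= s.+1 * #|Q|)%N.
Proof.
move=> QO Qup; set BB := [set B in F | _].
have BBP B : B \in BB -> B \in F /\
    exists i, [/\ i \in Q, i \in B & (#|above w O i :&: B| + s = mu B)%N].
  rewrite inE => /andP[BF /exists_inP[i iQ /andP[iB /eqP e]]].
  by split=> //; exists i.
pose tr (B : {set T}) := Q :&: B.
have fib (P : {set T}) : P \in tr @: BB ->
    (#|[set B in BB | tr B == P]| <= if (1 < #|P|)%N then s else 1)%N.
  move=> /imsetP[B0 B0B P0]; have [_ [x [xQ xB0 _]]] := BBP B0 B0B.
  have FB : [set B in BB | tr B == P] \subset F.
    by apply/subsetP => B; rewrite inE => /andP[/BBP[]].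
  have xP : x \in P by rewrite P0 inE xQ.
  have bounds B : B \in [set B in BB | tr B == P] ->
      [&& x \in B, #|P| <= mu B, s <= mu B & mu B < #|P| + s]%N.
    rewrite inE => /andP[BBB /eqP trB]; have [BF [i [iQ iB e]]] := BBP B BBB.
    apply/and4P; split.
    - by move: xP; rewrite -trB inE => /andP[].
    - apply: leq_trans (indepP indepO BF); rewrite -trB.
      exact/subset_leq_card/setSI.
    - by rewrite -e leq_addl.
    - rewrite -e ltn_add2r -trB; apply/proper_card/properP; split.
        apply: setSI; apply/subsetP => j; rewrite inE => /andP[jO ij].
        by apply: (Qup i) => //; apply: ltW.
      by exists i; rewrite !inE ?iQ // ltxx andbF.
  have [P1|P1] := ltnP 1 #|P|.
    apply: (card_chain_le (x := x) (a := #|P|)) => // B /bounds/and4P[-> -> _ ->] //.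
  have {}P1 : #|P| = 1%N.
    by apply/eqP; rewrite eqn_leq P1; apply/card_gt0P; exists x.
  apply: (card_chain_le (x := x) (a := s)) => // B /bounds/and4P[-> _ -> +].
  by rewrite P1 addnC.
have BBsum : #|BB| = (\sum_(P in tr @: BB) #|[set B in BB | tr B == P]|)%N.
  rewrite -sum1_card (partition_big_imset tr) /=.
  by apply: eq_bigr => P _; rewrite -sum1_card; apply: eq_bigl => B; rewrite inE.
apply: (@leq_trans (\sum_(P in tr @: BB) (if 1 < #|P| then s else 1))%N).
  by rewrite BBsum; apply: leq_sum => P; apply: fib.
rewrite (bigID (fun P : {set T} => 1 < #|P|)%N) /=.
have trQ (P : {set T}) : P \in tr @: BB -> P \subset Q.
  by move=> /imsetP[B _ ->]; apply: subsetIl.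
rewrite mulSn addnC; apply: leq_add.
  rewrite (eq_bigr (fun=> 1%N)); last by move=> P /andP[_ /negPf->].
  rewrite sum1_card; apply: leq_trans (leq_imset_card set1 Q).
  apply/subset_leq_card/subsetP => P /andP[PB]; rewrite -leqNgt => P1.
  have /imsetP[B /BBP[_ [i [iQ iB _]]] eP] := PB.
  have iP : i \in P by rewrite eP inE iQ.
  apply/imsetP; exists i => //; apply/esym/eqP.
  by rewrite eqEcard sub1set iP cards1.
rewrite (eq_bigr (fun=> s)); last by move=> P /andP[_ ->].
rewrite sum_nat_const mulnC leq_mul2l; apply/orP; right.
rewrite (_ : #|_| = #|[set P in tr @: BB | 1 < #|P|]%N|); last first.
  by apply: eq_card => P; rewrite [RHS]inE.
apply: laminar_card_le; last first.
  by move=> P; rewrite inE => /andP[/trQ].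
apply/forall_inP => P1; rewrite inE => /andP[/imsetP[A /BBP[AF _] ->] _].
apply/forall_inP => P2; rewrite inE => /andP[/imsetP[B /BBP[BF _] ->] _].
move/forall_inP: lamF => /(_ A AF)/forall_inP/(_ B BF)/or3P[AB|BA|dis].
- by rewrite setIS.
- by rewrite (setIS _ BA) orbT.
- by rewrite (disjointWl (subsetIr _ _)) ?orbT // (disjointWr (subsetIr _ _)).
Qed.

(** In a fixed [B] the number of optimal elements above [i] strictly decreases as [i] gets heavier
    within [O]. So each [B] has slack [s] for at most one [i], and on an upper set counting pairs
    amounts to counting members. *)
Lemma sum_slack_eq s :
  \sum_(i in O) w i * #|[set B in F | (i \in B) &&
     (#|above w O i :&: B| + s == mu B)%N]|%:R <= s.+1%:R * wsum w O.
Proof.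
pose c i := #|[set B in F | (i \in B) && (#|above w O i :&: B| + s == mu B)%N]|.
rewrite -subr_le0 /wsum mulr_sumr -sumrB.
rewrite (eq_bigr (fun i => w i * ((c i)%:R - s.+1%:R))); last first.
  by move=> i _; rewrite mulrBr [X in _ - X]mulrC.
apply: abel_sum_le0 => // x xO.
rewrite sumrB subr_le0 -!natr_sum ler_nat sum_nat_const mulnC.
pose Q := [set i in O | w x <= w i].
have sumQ (f : T -> nat) : (\sum_(i in O | (w x <= w i)%R) f i = \sum_(i in Q) f i)%N.
  by apply: eq_bigl => i; rewrite inE.
have -> : #|[pred i in O | w x <= w i]| = #|Q|.
  by apply: eq_card => i; rewrite [RHS]inE.
rewrite sumQ; apply: leq_trans (card_slack_sets (Q := Q) s _ _); last first.
- move=> i j; rewrite !inE => /andP[_ xi] -> ij /=; exact: le_trans ij.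
- by apply/subsetP => i; rewrite inE => /andP[].
rewrite -sum1_card (eq_bigr (fun i => \sum_(B in F)
  ((i \in B) && (#|above w O i :&: B| + s == mu B)) : nat)%N); last first.
  move=> i _; rewrite /c -sum1_card big_mkcond [RHS]big_mkcond /=.
  by apply: eq_bigr => B _; rewrite inE; case: (B \in F) => //=; case: (_ && _).
rewrite exchange_big /= [leqRHS]big_mkcond [leqLHS]big_mkcond /=.
apply: leq_sum => B _; rewrite inE; case: (B \in F) => //=.
have [/exists_inP[i iQ Hi]|/exists_inPn none] := ifPn; last first.
  by rewrite big1 // => i iQ; rewrite (negPf (none i iQ)).
rewrite (bigD1 i) //= Hi big1 // => j /andP[jQ ji].
apply/eqP; rewrite eqb0; apply/negP => Hj.
have strict a b : a \in O -> b \in O -> b \in B -> w a < w b ->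
    (#|above w O b :&: B| < #|above w O a :&: B|)%N.
  move=> aO bO bB ab; apply/proper_card/properP; split.
    by apply/setSI/above_mono/ltW.
  by exists b; rewrite !inE ?bO ?ab ?bB // ltxx andbF.
move: Hi Hj iQ jQ => /andP[iB /eqP ei] /andP[jB /eqP ej].
rewrite !inE => /andP[iO _] /andP[jO _].
have [ij|ji'|/w_inj e] := ltgtP (w i) (w j).
- by have := strict i j iO jO jB ij; rewrite -(ltn_add2r s) ei ej ltnn.
- by have := strict j i jO iO iB ji'; rewrite -(ltn_add2r s) ei ej ltnn.
- by rewrite e eqxx in ji.
Qed.

Lemma sum_slack_le u :
  \sum_(i in O) w i * #|[set B in F | (i \in B) &&
     (mu B - #|above w O i :&: B| <= u)%N]|%:R
  <= (\sum_(s < u) s.+2)%:R * wsum w O.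
Proof.
rewrite natr_sum mulr_suml.
apply: le_trans (ler_sum _ (fun (s : 'I_u) _ => sum_slack_eq s.+1)).
rewrite exchange_big /=; apply: ler_sum => i iO.
rewrite -mulr_sumr ler_wpM2l // -natr_sum ler_nat.
rewrite -sum1_card (eq_bigr (fun s : 'I_u => \sum_(B in F)
  ((i \in B) && (#|above w O i :&: B| + s.+1 == mu B)) : nat)%N); last first.
  move=> s _; rewrite -sum1_card big_mkcond [RHS]big_mkcond /=.
  by apply: eq_bigr => B _; rewrite inE; case: (B \in F) => //=; case: (_ && _).
rewrite exchange_big /= [leqRHS]big_mkcond [leqLHS]big_mkcond /=.
apply: leq_sum => B _; rewrite inE; case: (boolP (B \in F)) => //= BF.
case: ifP => // /andP[iB Hu].
(* The element [i] itself takes a place in [B], so the slack is some [s.+1] with [s < u]; this is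
   why the weights start at 2. *)
have lt_mu : (#|above w O i :&: B| < mu B)%N.
  apply: leq_trans (indepP indepO BF); apply/proper_card/properP; split.
    by apply/setSI/aboveS.
  by exists i; rewrite !inE ?iO ?iB // ltxx andbF.
have su : ((mu B - #|above w O i :&: B|).-1 < u)%N by rewrite prednK // subn_gt0.
rewrite (bigD1 (Ordinal su)) //= iB prednK ?subn_gt0 // subnKC ?eqxx //.
exact: ltnW.
Qed.

End SlackCounting.

(** * From random orders to independent samples *)

Section RandomOrder.
Variables (R : realFieldType) (n : nat).

Lemma exists_sampleS (A : {set 'I_n}) : exists s : {perm 'I_n}, sampleS s #|A| = A.
Proof.
pose l := enum A ++ enum (~: A).
have size_l : size l = n by rewrite size_cat -!cardE cardsC card_ord.
have ul : uniq l.
  rewrite cat_uniq !enum_uniq /= andbT; apply/hasPn => x.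
  by rewrite !mem_enum inE.
pose f (k : 'I_n) := nth k l k.
have f_inj : injective f.
  move=> i j; rewrite /f (set_nth_default i) ?size_l // => /eqP.
  by rewrite nth_uniq ?size_l // => /eqP/val_inj.
exists (perm f_inj); apply/eqP; rewrite eqEcard; apply/andP; split.
  apply/subsetP => _ /imsetP[k kA ->]; rewrite permE /f nth_cat -cardE.
  by move: kA; rewrite inE => kA; rewrite kA -mem_enum mem_nth // -cardE.
rewrite card_imset; last exact: perm_inj.
have An : (#|A| <= n)%N by rewrite -[X in (_ <= X)%N]card_ord max_card.
have wI : injective (widen_ord An) by move=> i j /(congr1 val) e; apply: val_inj.
rewrite -[leqLHS](card_ord #|A|) -(card_imset _ wI).
apply/subset_leq_card/subsetP => _ /imsetP[k _ ->].
by rewrite inE /=.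
Qed.

(** Double counting of [g (s @: S)] over permutations [s] and sets [S] of size [t]: for fixed [S]
    translate [s] so that [S] becomes a prefix; for fixed [s] the image map permutes these sets. *)
Lemma sum_perm_sampleS t (g : {set 'I_n} -> R) :
  'C(n, t)%:R * (\sum_(s : {perm 'I_n}) g (sampleS s t)) =
  n`!%:R * (\sum_(S : {set 'I_n} | #|S| == t) g S).
Proof.
transitivity (\sum_(S : {set 'I_n} | #|S| == t) \sum_(s : {perm 'I_n}) g (s @: S)).
  rewrite [RHS](eq_bigr (fun=> \sum_(s : {perm 'I_n}) g (sampleS s t))).
    rewrite sumr_const mulr_natl; congr (_ *+ _).
    by rewrite -[in LHS](card_ord n) -card_draws; apply: eq_card => S; rewrite !inE.
  move=> S /eqP St; have [r rS] := exists_sampleS S; rewrite St in rS.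
  rewrite [RHS](reindex_inj (mulgI r)); apply: eq_bigr => s _; congr g.
  rewrite -{1}rS /sampleS -imset_comp; apply: eq_imset => k.
  by rewrite /= permM.
rewrite exchange_big /= (eq_bigr (fun=> \sum_(S : {set 'I_n} | #|S| == t) g S)).
  rewrite sumr_const mulr_natl; congr (_ *+ _).
  by rewrite -card_Sn; apply: eq_card => s; rewrite !inE.
move=> s _; rewrite [RHS](reindex_inj (imset_inj (@perm_inj _ s))).
by apply: eq_bigl => S; rewrite card_imset //; apply: perm_inj.
Qed.

(** For [q = 1 - p]: a prefix of binomial length of a uniform order contains each element
    independently with probability [q]. *)
Lemma expected_sampleS (p q : R) (g : {set 'I_n} -> R) :
  (n`!%:R)^-1 * (\sum_(s : {perm 'I_n}) \sum_(t < n.+1)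
     ('C(n, t)%:R * q ^+ t * p ^+ (n - t) * g (sampleS s t))) =
  \sum_(S : {set 'I_n}) q ^+ #|S| * p ^+ (n - #|S|) * g S.
Proof.
have n0 : n`!%:R != 0 :> R by rewrite pnatr_eq0 -lt0n fact_gt0.
apply: (mulfI n0); rewrite mulVKf // exchange_big /=.
have Sn (S : {set 'I_n}) : (#|S| < n.+1)%N.
  by rewrite ltnS -[X in (_ <= X)%N]card_ord max_card.
rewrite [in RHS](partition_big (fun S => Ordinal (Sn S)) xpredT) //= mulr_sumr.
apply: eq_bigr => t _.
rewrite (eq_bigr (fun s : {perm 'I_n} =>
  (q ^+ t * p ^+ (n - t)) * ('C(n, t)%:R * g (sampleS s t)))); last first.
  by move=> s _; ring.
rewrite -mulr_sumr -mulr_sumr sum_perm_sampleS mulrCA; congr (_ * _).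
rewrite mulr_sumr; apply: eq_big => [S|S /eqP-> //].
by rewrite -val_eqE.
Qed.

End RandomOrder.

(** * Numerical bounds for [p = 0.08] *)

Section Numerics.
Variable R : realFieldType.
Let p : R := 8%:R / 100%:R.
Let q : R := 1 - p.

(* The coefficients make [a^x b^y] harmonic for the walk. *)
Lemma ruin_le x y : ruin p q x y <= (2 * p) ^+ x * (2 * q) ^+ y.
Proof.
have p0 : 0 <= p by rewrite /p; lra.
have q1 : 1 <= 2 * q by rewrite /q /p; lra.
have q0 : 0 <= q by rewrite /q /p; lra.
elim: x y => [|x IHx] y; first by rewrite mul1r exprn_ege1.
elim: y => [|y IHy].
  by rewrite ruinS0 mulr_ge0 // exprn_ge0 // mulr_ge0.
rewrite ruinSS; have := IHx y.+1; move: IHy; rewrite !exprS.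
set a := (2 * p) ^+ x; set b := (2 * q) ^+ y => h1 h2.
have := ler_wpM2l p0 h2; have := ler_wpM2l q0 h1; nra.
Qed.

Lemma ruin_weight_tail m :
  \sum_(6 <= u < 6 + m) ruin p q u.+1 u.+1 * (\sum_(s < u.+1) s.+2)%:R
  <= 12 / 1000.
Proof.
have S2 u : (2 * \sum_(s < u.+1) s.+2 = u.+1 * (u + 4))%N.
  by elim: u => [|u IH]; rewrite ?big_ord1 // big_ord_recr /= mulnDr IH; nia.
pose c := (4 * p * q)%R.
(* Here [c] is 0.2944. The weights are 35 at [u = 6] and grow by a factor at most 44/35 from there
   on, so the terms are dominated by a geometric series of ratio 2/5, since
   [c * 44 <= 35 * 2 / 5]. *)
suff H k : ruin p q (6 + k).+1 (6 + k).+1 * (\sum_(s < (6 + k).+1) s.+2)%:R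
    <= 35%:R * c ^+ 7 * (2 / 5) ^+ k.
  rewrite -{1}[6%N]add0n big_addn addKn.
  apply: (@le_trans _ _ (\sum_(0 <= k < m) 35%:R * c ^+ 7 * (2 / 5) ^+ k)).
    by apply: ler_sum => k _; rewrite addnC.
  suff : \sum_(0 <= k < m) 35%:R * c ^+ 7 * (2 / 5) ^+ k =
      35%:R * c ^+ 7 * ((1 - (2/5) ^+ m) * (5 / 3)).
    move=> ->; have : 0 <= (2 / 5 : R) ^+ m by rewrite exprn_ge0 //; lra.
    have : 35%:R * c ^+ 7 <= 72 / 10000 by rewrite /c /q /p; lra.
    have : 0 <= c by rewrite /c /q /p; lra.
    move=> /(exprn_ge0 7); set C := c ^+ 7; set D := _ ^+ m; nra.
  elim: m => [|m IH]; first by rewrite big_nil expr0; ring.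
  rewrite big_nat_recr //= IH [(2 / 5) ^+ m.+1]exprS.
  by move: (c ^+ 7) ((2 / 5) ^+ m) => C D; lra.
have cE x : (2 * p) ^+ x * (2 * q) ^+ x = c ^+ x :> R.
  by rewrite -exprMn; congr (_ ^+ _); rewrite /c; ring.
have c0 : 0 <= c by rewrite /c /q /p; lra.
have := ruin_le (6 + k).+1 (6 + k).+1; rewrite cE => /ler_wpM2r h.
apply: le_trans (h _ _) _; rewrite ?ler0n //.
elim: k {h} => [|k IH]; first by rewrite addn0 !big_ord_recr big_ord0 expr0 mulr1 mulrC.
have ratio : (35 * \sum_(s < (6 + k).+2) s.+2 <= 44 * \sum_(s < (6 + k).+1) s.+2)%N.
  have := S2 (6 + k)%N; have := S2 (7 + k)%N; clear; rewrite !addSn; nia.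
move: ratio; rewrite -(ler_nat R) !natrM addnS => ratio.
have A0 : 0 <= c ^+ (6 + k).+1 by rewrite exprn_ge0.
have c1 : c * 44%:R <= 14%:R by rewrite /c /q /p; lra.
move: IH ratio A0; rewrite [c ^+ (6 + k).+2]exprS [(2 / 5) ^+ k.+1]exprS.
set A := c ^+ (6 + k).+1; set N := (_)%:R; set N' := (_)%:R.
set D := (2 / 5) ^+ k; set C := c ^+ 7 => IH ratio A0.
have N0 : 0 <= N by rewrite ler0n.
have cA0 : 0 <= c * A by rewrite mulr_ge0.
have h1 := ler_wpM2l cA0 ratio.
have h2 : A * N * (c * 44%:R) <= A * N * 14%:R by rewrite ler_wpM2l // mulr_ge0.
lra.
Qed.

Lemma ruin_weight m :
  \sum_(0 <= u < m) ruin p q u.+1 u.+1 * (\sum_(s < u.+1) s.+2)%:R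
  <= 27%:R / 80%:R.
Proof.
apply: (@le_trans _ _ (\sum_(0 <= u < 6 + m)
    ruin p q u.+1 u.+1 * (\sum_(s < u.+1) s.+2)%:R)).
  rewrite (big_cat_nat (n := m) (p := (6 + m)%N)) ?leq_addl //= lerDl.
  apply: sumr_ge0 => u _; apply: mulr_ge0; last exact: ler0n.
  by rewrite ruin_ge0 // /q /p; lra.
(* Six terms, with weights 2, 5, 9, 14, 20, 27, are bounded through the recursion with decimals
   rounded up; the tail adds at most 0.012. *)
rewrite (big_cat_nat (n := 6)) ?leq_addr //=.
have := ruin_weight_tail m; set tail := bigop _ _ _ => tail_le.
rewrite !big_nat_recr //= big_geq // !big_ord_recr big_ord0 /=.
have E x y : ruin p q x.+1 y.+1 =
    8 / 100 * ruin p q x y.+1 + 92 / 100 * ruin p q x.+1 y.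
  by rewrite ruinSS /q /p; congr (_ + _ * _); lra.
have E0 y : ruin p q 0 y = 1 := ruin0 p q y.
have E1 x : ruin p q x.+1 0 = 0 := ruinS0 p q x.
move: (ruin p q) E E0 E1 => r E E0 E1.
(* Stopping the unfolding at [y = 3] keeps the expressions small. *)
have E3 x y : r x.+1 y.+4 = 8 / 100 * r x y.+4 + 92 / 100 * r x.+1 y.+3 := E x _.
have r13 : r 1%N 3%N <= 222 / 10 ^+ 3 by rewrite !(E, E0, E1); lra.
have r23 : r 2%N 3%N <= 345 / 10 ^+ 4 by rewrite !(E, E0, E1); lra.
have r33 : r 3%N 3%N <= 453 / 10 ^+ 5 by rewrite !(E, E0, E1); lra.
have r43 : r 4%N 3%N <= 539 / 10 ^+ 6 by rewrite !(E, E0, E1); lra.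
have r53 : r 5%N 3%N <= 600 / 10 ^+ 7 by rewrite !(E, E0, E1); lra.
have r63 : r 6%N 3%N <= 637 / 10 ^+ 8 by rewrite !(E, E0, E1); lra.
have r11 : r 1%N 1%N <= 8 / 10 ^+ 2 by rewrite !(E, E0, E1); lra.
have r22 : r 2%N 2%N <= 182 / 10 ^+ 4 by rewrite !(E, E0, E1); lra.
have r44 : r 4%N 4%N <= 118 / 10 ^+ 5 by rewrite !(E3, E0); lra.
have r55 : r 5%N 5%N <= 315 / 10 ^+ 6 by rewrite !(E3, E0); lra.
have r66 : r 6%N 6%N <= 852 / 10 ^+ 7 by rewrite !(E3, E0); lra.
move: tail_le; lra.
Qed.

End Numerics.

(** * Union bound and the competitive ratio *)

Lemma le_term_sum (R : realFieldType) (I : finType) (P : pred I) (f : I -> R) i :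
  P i -> (forall j, 0 <= f j) -> f i <= \sum_(j | P j) f j.
Proof. by move=> Pi f0; rewrite (bigD1 i) //= lerDl sumr_ge0. Qed.

Section Competitive.
Variables (R : realFieldType) (n : nat) (F : {set {set 'I_n}}).
Variables (mu : {set 'I_n} -> nat) (w : 'I_n -> R).
Hypothesis lamF : laminar F.
Hypothesis TF : setT \in F.
Hypothesis mu_mono :
  forall A B, A \in F -> B \in F -> A \proper B -> (mu A < mu B)%N.
Hypothesis w_ge0 : forall x, 0 <= w x.
Hypothesis w_inj : injective w.

Let O := OPT F mu w setT setT.
Definition slack (i : 'I_n) (B : {set 'I_n}) := (mu B - #|above w O i :&: B|)%N.
Variable M : nat.
Hypothesis mu_le_M : forall B, B \in F -> (mu B <= M)%N.

Definition jam (S : {set 'I_n}) i (B : {set 'I_n}) u :=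
  (i \notin S) && (u <= #|cars F mu w S i B u|)%N.

(** A union bound over all places and thresholds of a rejection. Thresholds are written [u.+1]
    because the slack of an optimal element is positive; [M] keeps them in a finite type. *)
Definition jams (S : {set 'I_n}) i : R :=
  \sum_(B in F | i \in B) \sum_(u < M | (slack i B <= u.+1 <= mu B)%N)
    (jam S i B u.+1)%:R.

Lemma slack_gt0 i B : i \in O -> B \in F -> i \in B -> (0 < slack i B)%N.
Proof.
move=> iO BF iB; rewrite subn_gt0; move: iO; rewrite /O.
rewrite mem_OPT_free ?in_setT // => fi.
exact: freeP fi BF iB (subsetT B).
Qed.

Lemma mem_arrivals (s : {perm 'I_n}) t i :
  (i \in arrivals s t) = (i \notin sampleS s t).
Proof.
have -> : i = s (s^-1 i)%g by rewrite permKV.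
rewrite mem_map; last exact: perm_inj.
rewrite /sampleS mem_imset; last exact: perm_inj.
by rewrite mem_filter mem_enum andbT inE -leqNgt.
Qed.

Lemma jams_KickNext s t i : i \in O ->
  (i \notin sampleS s t)%:R - jams (sampleS s t) i <=
  (i \in KickNext F mu w s t)%:R.
Proof.
set S := sampleS s t => iO.
have jams0 : 0 <= jams S i by do 2![apply: sumr_ge0 => ? _].
have [iS|iS] := boolP (i \in S).
  by rewrite sub0r; apply: le_trans (ler0n _ _); rewrite oppr_le0.
have [/exists_inP[B BF /andP[iB /existsP[u /andP[su ju]]]]|] :=
    boolP [exists B in F, (i \in B) &&
      [exists u : 'I_M, (slack i B <= u.+1 <= mu B)%N && jam S i B u.+1]].
  apply: le_trans (ler0n _ _); rewrite subr_le0.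
  have := @le_term_sum R _ (fun v : 'I_M => (slack i B <= v.+1 <= mu B)%N)
    (fun v => (jam S i B v.+1)%:R) u su (fun v => ler0n _ _).
  rewrite ju => /le_trans; apply.
  apply: (@le_term_sum R _ (fun C : {set 'I_n} => (C \in F) && (i \in C))
    (fun C => \sum_(v < M | (slack i C <= v.+1 <= mu C)%N) (jam S i C v.+1)%:R) B).
    by rewrite BF iB.
  by move=> C; apply: sumr_ge0 => v _; apply: ler0n.
move=> /exists_inPn nojam; rewrite (_ : i \in KickNext F mu w s t).
  by rewrite lerBlDr lerDl.
apply: KickNext_accepts => //.
- rewrite map_inj_uniq; last exact: perm_inj.
  by rewrite filter_uniq // enum_uniq.
- by move=> j; rewrite mem_arrivals inE.
- move=> B BF iB u /andP[ul uB]; rewrite ltnNge; apply/negP => ju.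
  (* The sample has at most as many slots above [i] as [O] has elements above [i] in [B], so every
     threshold relevant to [unjammed] is at least the slack. *)
  have su : (slack i B <= u)%N.
    apply: leq_trans ul; apply: leq_sub2l.
    exact: (above_OPT_global lamF mu_mono w_ge0 w_inj).
  have u0 : (0 < u)%N := leq_trans (slack_gt0 iO BF iB) su.
  have uM : (u.-1 < M)%N.
    by rewrite prednK // (leq_trans uB) // mu_le_M.
  move: (nojam B BF); rewrite iB /= => /existsPn/(_ (Ordinal uM)).
  by rewrite /= prednK // su uB /jam iS ju.
- by rewrite mem_arrivals.
Qed.

Let p : R := 8%:R / 100%:R.
Let q : R := 1 - p.
Let Pr (S : {set 'I_n}) := q ^+ #|S| * p ^+ (n - #|S|).

Let p_ge0 : 0 <= p. Proof. by rewrite /p; lra. Qed.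
Let q_ge0 : 0 <= q. Proof. by rewrite /q /p; lra. Qed.
Let pq1 : q + p = 1. Proof. by rewrite /q; ring. Qed.

Lemma expected_jams i :
  \sum_(S : {set 'I_n}) Pr S * jams S i <=
  p * \sum_(u < M) ruin p q u.+1 u.+1 *
    #|[set B in F | (i \in B) && (slack i B <= u.+1)%N]|%:R.
Proof.
apply: (@le_trans _ _ (\sum_(B in F | i \in B)
    \sum_(u < M | (slack i B <= u.+1 <= mu B)%N) p * ruin p q u.+1 u.+1)).
  under eq_bigr do rewrite mulr_sumr; rewrite exchange_big /=.
  apply: ler_sum => B /andP[BF iB].
  under eq_bigr do rewrite mulr_sumr; rewrite exchange_big /=.
  apply: ler_sum => u /andP[_ uB].
  have := jam_probability p_ge0 q_ge0 pq1 lamF mu_mono w_ge0 w_inj BF uB i.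
  by rewrite card_ord.
rewrite mulr_sumr.
under [leRHS]eq_bigr => u _.
  rewrite mulrA -sum1_card natr_sum mulr_sumr big_mkcond /=.
  under eq_bigr do rewrite inE andbA.
  over.
rewrite exchange_big /= big_mkcond; apply: ler_sum => B _.
have [BF|BF] := ifP; last by rewrite big1.
rewrite [leLHS]big_mkcond; apply: ler_sum => u _; rewrite mulr1.
case: (_ <= _)%N => //=; case: ifP => // _.
by rewrite mulr_ge0 ?ruin_ge0.
Qed.

Lemma wsum_OPT_le_expected :
  (53%:R / 1000%:R) * wsum w O <= expected_KickNext F mu w p.
Proof.
(* A lower bound on the output weight that depends on the sample only, so that [expected_sampleS]
   applies. *)
pose g (S : {set 'I_n}) := \sum_(i in O) w i * ((i \notin S)%:R - jams S i).
have gK s t : g (sampleS s t) <= wsum w (KickNext F mu w s t).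
  apply: (@le_trans _ _ (\sum_(i in O) w i * (i \in KickNext F mu w s t)%:R)).
    by apply: ler_sum => i iO; apply: ler_wpM2l => //; apply: jams_KickNext.
  rewrite /wsum big_mkcond [leRHS]big_mkcond /=; apply: ler_sum => i _.
  by case: (i \in O); case: (i \in KickNext _ _ _ _ _); rewrite ?mulr1 ?mulr0.
apply: (@le_trans _ _ (\sum_(S : {set 'I_n}) Pr S * g S)); last first.
  rewrite -expected_sampleS /expected_KickNext ler_wpM2l ?invr_ge0 ?ler0n //.
  apply: ler_sum => s _; apply: ler_sum => t _; apply: ler_wpM2l => //.
  by rewrite !mulr_ge0 ?exprn_ge0.
have -> : \sum_(S : {set 'I_n}) Pr S * g S =
    \sum_(i in O) w i * (p - \sum_(S : {set 'I_n}) Pr S * jams S i).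
  under eq_bigr do rewrite mulr_sumr; rewrite exchange_big /=.
  apply: eq_bigr => i iO; rewrite -[in RHS](miss_probability pq1 i) card_ord.
  rewrite -sumrB mulr_sumr; apply: eq_bigr => S _; rewrite /Pr; ring.
have weights : \sum_(u < M) ruin p q u.+1 u.+1 * (\sum_(s < u.+1) s.+2)%:R
    <= 27%:R / 80%:R.
  by have := ruin_weight R M; rewrite big_mkord.
have W0 : 0 <= wsum w O by apply: sumr_ge0 => i _.
apply: (@le_trans _ _ (p * (wsum w O - \sum_(u < M) ruin p q u.+1 u.+1 *
    ((\sum_(s < u.+1) s.+2)%:R * wsum w O)))).
  under eq_bigr do rewrite mulrA; rewrite -mulr_suml.
  (* The constants meet exactly: 0.08 times 1 - 27/80 is 0.053. *)
  have := ler_wpM2r W0 weights; rewrite /p; lra.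
apply: (@le_trans _ _ (\sum_(i in O) w i * (p - p * \sum_(u < M)
    ruin p q u.+1 u.+1 * #|[set B in F | (i \in B) && (slack i B <= u.+1)%N]|%:R))).
  have -> : \sum_(i in O) w i * (p - p * \sum_(u < M) ruin p q u.+1 u.+1 *
        #|[set B in F | (i \in B) && (slack i B <= u.+1)%N]|%:R) =
      p * (wsum w O - \sum_(u < M) ruin p q u.+1 u.+1 * \sum_(i in O) w i *
        #|[set B in F | (i \in B) && (slack i B <= u.+1)%N]|%:R).
    under [in RHS]eq_bigr do rewrite mulr_sumr; rewrite exchange_big /=.
    rewrite -sumrB mulr_sumr; apply: eq_bigr => i iO.
    under [in RHS]eq_bigr do rewrite mulrCA; rewrite -mulr_sumr; ring.
  apply: ler_wpM2l => //; rewrite lerD2l lerN2; apply: ler_sum => u _.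
  apply: ler_wpM2l; first exact: ruin_ge0.
  exact: (sum_slack_le lamF mu_mono w_ge0 w_inj (OPT_indep _ _ _ _ _)).
apply: ler_sum => i iO; apply: ler_wpM2l => //.
by rewrite lerD2l lerN2; apply: expected_jams.
Qed.

End Competitive.

Theorem theorem2 (R : realFieldType) (n : nat) (F : {set {set 'I_n}})
    (mu : {set 'I_n} -> nat) (w : 'I_n -> R) :
  laminar F ->
  setT \in F ->
  (forall A, A \in F -> (0 < mu A)%N) ->
  (forall A B, A \in F -> B \in F -> A \proper B -> (mu A < mu B)%N) ->
  (forall x, 0 <= w x) ->
  injective w ->
  (53%:R / 1000%:R) * wsum w (OPT F mu w setT setT)
    <= expected_KickNext F mu w (8%:R / 100%:R).
Proof.
move=> lamF TF _ mu_mono w_ge0 w_inj.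
apply: (wsum_OPT_le_expected lamF TF mu_mono w_ge0 w_inj (M := (\max_(B in F) mu B)%N)).
by move=> B BF; apply: leq_bigmax_cond.
Qed.
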